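(* Let $\beta\in\mathbf{C}$ with $0<|\beta|<1$, and let $A=T_{1+\beta z}^{-1}T_{\overline z}T_{1+\beta z}$, an operator on the Hardy space $H^2$. Then $$\max\left\{1,\frac{|\beta|}{\sqrt{1-|\beta|^2}}\right\}\le M(A)\le 1+\frac{|\beta|}{\sqrt{1-|\beta|^2}}$$ and $$\max\left\{1,\frac{c_0|\beta|}{\sqrt{1-|\beta|^2}}\right\}\le P(A)\le \min\left\{M(A),\,1+\frac{c_0|\beta|}{\sqrt{1-|\beta|^2}}\right\},$$ where $c_0=\frac{\sqrt2(\sqrt5-1)}{(1+\sqrt5)^{3/2}}$.
   Context: $H^2$ is the Hardy space of the unit circle $\partial\mathbf{D}$: the closed linear span in $L^2(\partial\mathbf{D},\theta)$ ($d\theta$ being normalized arc length measure) of $\{z^n : n=0,1,2,\dots\}$, where $z(e^{it})=e^{it}$. For $f\in L^\infty(\partial\mathbf{D},\theta)$ the Toeplitz operator $T_f$ on $H^2$ is $T_fh=\mathcal{P}(fh)$, where $\mathcal{P}$ is the orthogonal projection of $L^2(\partial\mathbf{D},\theta)$ onto $H^2$. For a bounded operator $A$ with spectrum $\sigma(A)$ contained in the closed unit disk $\overline{\mathbf{D}}$, set $M(A)=\sup_{n\ge 0}\|A^n\|$ (over integers $n\geq 0$, with $A^0=I$) and $P(A)=\sup_{|\lambda|>1}\mathrm{dist}(\lambda,\sigma(A))\,\|(\lambda I-A)^{-1}\|$, norms being operator norms. *)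

(* Defs.v *)
From HB Require Import structures.
From mathcomp Require Import all_boot all_order all_algebra.
From mathcomp Require Import generic_quotient ring_quotient.
From mathcomp Require Import all_classical all_reals all_analysis.
From mathcomp Require Import measurable_realfun hoelder uniform_distribution.
From mathcomp Require Import complex ring lra.
Set Implicit Arguments.
Unset Strict Implicit.
Unset Printing Implicit Defensive.
Import Order.TTheory GRing.Theory Num.Theory.
Import numFieldNormedType.Exports.
Import ComplexField.
Local Open Scope classical_set_scope.
Local Open Scope ring_scope.
Local Open Scope complex_scope.
Local Open Scope quotient_scope.

Notation normc := ComplexField.Normc.normc.

(* The library's measurability and integrals are for real-valued functions;
   complex-valued functions are handled through their real and imaginary
   parts. *)
Section ComplexL2.
Context d (T : measurableType d) (R : realType).
Variable mu : {measure set T -> \bar R}.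
Implicit Types f g : T -> R[i].

Definition measurablec f :=
  measurable_fun setT (fun t => complex.Re (f t)) /\
  measurable_fun setT (fun t => complex.Im (f t)).

Definition sqr_integrable f :=
  measurablec f /\ mu.-integrable setT (fun t => (normc (f t) ^+ 2)%:E).

Definition ess_bounded f :=
  measurablec f /\ exists M : R, {ae mu, forall t, normc (f t) <= M}.

Definition L2norm f : R := Num.sqrt (\int[mu]_t (normc (f t) ^+ 2))%R.

(* Linear in the first argument. *)
Definition L2dot f g : R[i] :=
  (\int[mu]_t complex.Re (f t * (g t)^*%C))%R +i*
  (\int[mu]_t complex.Im (f t * (g t)^*%C))%R.

Lemma normcE2 (z : R[i]) :
  normc z ^+ 2 = complex.Re z ^+ 2 + complex.Im z ^+ 2.
Proof. by case: z => a b /=; rewrite sqr_sqrtr// addr_ge0 ?sqr_ge0. Qed.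

Lemma normc_ge0 (z : R[i]) : 0 <= normc z.
Proof. by case: z => a b /=; rewrite sqrtr_ge0. Qed.

Lemma ler_normcD (x y : R[i]) : normc (x + y) <= normc x + normc y.
Proof. by rewrite -lecR rmorphD; exact: (ler_normD x y). Qed.

Lemma measurable_normc f : measurablec f ->
  measurable_fun setT (fun t => normc (f t)).
Proof.
move=> [mr mi].
have -> : (fun t => normc (f t)) =
  (fun t => Num.sqrt (complex.Re (f t) ^+ 2 + complex.Im (f t) ^+ 2)).
  by apply/funext => t; case: (f t).
apply: (measurableT_comp (measurable_funTS _)).
  by apply: continuous_measurable_fun; exact: sqrt_continuous.
by apply: measurable_funD; apply: measurable_funX.
Qed.

Lemma measurable_normc2 f : measurablec f ->
  measurable_fun setT (fun t => (normc (f t) ^+ 2)%:E).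
Proof. by move=> /measurable_normc mf; apply/measurable_EFinP/measurable_funX. Qed.

Lemma measurablecD f g : measurablec f -> measurablec g -> measurablec (f + g).
Proof.
move=> [fr fi] [gr gi]; split.
  have -> : (fun t => complex.Re ((f + g) t)) =
    (fun t => complex.Re (f t)) \+ (fun t => complex.Re (g t)).
    by apply/funext => t; rewrite !fctE /=; case: (f t) (g t) => ? ? [].
  exact: measurable_funD.
have -> : (fun t => complex.Im ((f + g) t)) =
  (fun t => complex.Im (f t)) \+ (fun t => complex.Im (g t)).
  by apply/funext => t; rewrite !fctE /=; case: (f t) (g t) => ? ? [].
exact: measurable_funD.
Qed.

Lemma measurablecM f g : measurablec f -> measurablec g -> measurablec (f * g).
Proof.
move=> [fr fi] [gr gi]; split.
  have -> : (fun t => complex.Re ((f * g) t)) =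
    (fun t => complex.Re (f t) * complex.Re (g t) -
              complex.Im (f t) * complex.Im (g t)).
    by apply/funext => t; rewrite !fctE /=; case: (f t) (g t) => ? ? [].
  by apply: measurable_funB; apply: measurable_funM.
have -> : (fun t => complex.Im ((f * g) t)) =
  (fun t => complex.Re (f t) * complex.Im (g t) +
            complex.Im (f t) * complex.Re (g t)).
  by apply/funext => t; rewrite !fctE /=; case: (f t) (g t) => ? ? [].
by apply: measurable_funD; apply: measurable_funM.
Qed.

Lemma measurablec_cst (a : R[i]) : measurablec (cst a).
Proof. by split; exact: measurable_cst. Qed.

Lemma measurablec_conj f : measurablec f -> measurablec (fun t => (f t)^*%C).
Proof.
move=> [fr fi]; split.
  have -> : (fun t => complex.Re (f t)^*%C) = (fun t => complex.Re (f t)).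
    by apply/funext => t; case: (f t).
  exact: fr.
have -> : (fun t => complex.Im (f t)^*%C) = (fun t => - complex.Im (f t)).
  by apply/funext => t; case: (f t).
exact: measurableT_comp.
Qed.

Lemma normcD2 (x y : R[i]) :
  normc (x + y) ^+ 2 <= 2 * normc x ^+ 2 + 2 * normc y ^+ 2.
Proof.
case: x y => a b [c e]; rewrite !normcE2 /=.
have := sqr_ge0 (a - c); have := sqr_ge0 (b - e); nra.
Qed.

Lemma sqr_integrableD f g :
  sqr_integrable f -> sqr_integrable g -> sqr_integrable (f + g).
Proof.
move=> [mf If] [mg Ig]; have mfg := measurablecD mf mg; split => //.
apply: (@le_integrable _ _ _ _ _ measurableT _
   (fun t => 2%:E * (normc (f t) ^+ 2)%:E + 2%:E * (normc (g t) ^+ 2)%:E)%E).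
- exact: measurable_normc2.
- move=> t _ /=; rewrite lee_fin !ger0_norm ?addr_ge0 ?mulr_ge0 ?exprn_ge0 ?normc_ge0//.
  exact: normcD2.
- exact: (integrableD measurableT (integrableZl measurableT 2 If)
                                 (integrableZl measurableT 2 Ig)).
Qed.

Lemma sqr_integrableM f g : ess_bounded f -> sqr_integrable g ->
  sqr_integrable (f * g).
Proof.
move=> [mf [M fM]] [mg Ig]; have mfg := measurablecM mf mg; split => //.
apply/integrableP; split; first exact: measurable_normc2.
have Ig' := integrableZl measurableT (M ^+ 2) Ig.
apply: le_lt_trans (_ : (\int[mu]_t ((M ^+ 2)%:E * (normc (g t) ^+ 2)%:E))%E < +oo)%E.
  apply: ae_ge0_le_integral => //.
  - by apply: measurableT_comp => //; exact: measurable_normc2.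
  - by move=> t _; rewrite mule_ge0// lee_fin sqr_ge0.
  - exact: measurable_int Ig'.
  apply: filterS fM => t fM _ /=.
  rewrite lee_fin ger0_norm ?sqr_ge0// Normc.normcM exprMn ler_wpM2r ?sqr_ge0//.
  by rewrite lerXn2r ?nnegrE ?normc_ge0// (le_trans _ fM) ?normc_ge0.
have /integrableP[_] := Ig'.
under eq_integral do rewrite gee0_abs ?mule_ge0 ?lee_fin ?sqr_ge0//.
by [].
Qed.

Lemma ess_bounded_cst a : ess_bounded (cst a).
Proof. by split; [exact: measurablec_cst|exists (normc a); exact: aeW]. Qed.

Lemma sqr_integrableZ a f : sqr_integrable f -> sqr_integrable (a *: f).
Proof. by move=> h; have := sqr_integrableM (ess_bounded_cst a) h. Qed.

Lemma sqr_integrable0 : sqr_integrable 0.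
Proof.
split; first exact: measurablec_cst.
rewrite (_ : (fun _ => _) = cst 0%E); first exact: integrable0.
by apply/funext => t; rewrite fctE Normc.normc0 expr0n.
Qed.

Definition L2pred : {pred T -> R[i]} := mem [set f | sqr_integrable f].

Lemma L2predP f : f \in L2pred <-> sqr_integrable f.
Proof. by rewrite inE. Qed.

Lemma L2pred_submod_closed : submod_closed L2pred.
Proof.
split; first by apply/L2predP; exact: sqr_integrable0.
move=> a f g /L2predP hf /L2predP hg; apply/L2predP.
by apply: sqr_integrableD => //; exact: sqr_integrableZ.
Qed.

HB.instance Definition _ :=
  GRing.isSubmodClosed.Build R[i] (T -> R[i]) L2pred L2pred_submod_closed.

Record L2fun := MkL2fun { L2fun_val :> T -> R[i]; L2funP : L2fun_val \in L2pred }.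
HB.instance Definition _ := [isSub for L2fun_val].
HB.instance Definition _ := [Choice of L2fun by <:].
HB.instance Definition _ := [SubChoice_isSubLmodule of L2fun by <:].

Lemma L2funDE (f g : L2fun) t : (f + g) t = f t + g t. Proof. by []. Qed.
Lemma L2funBE (f g : L2fun) t : (f - g) t = f t - g t. Proof. by []. Qed.
Lemma L2funZE a (f : L2fun) t : (a *: f) t = a * f t. Proof. by []. Qed.

Definition L2null : {pred L2fun} :=
  mem [set f : L2fun | {ae mu, forall t, f t = 0}].

Lemma L2nullP (f : L2fun) : f \in L2null <-> {ae mu, forall t, f t = 0}.
Proof. by rewrite inE. Qed.

Lemma L2null_zmod_closed : zmod_closed L2null.
Proof.
split; first by apply/L2nullP; exact: aeW.
move=> f g /L2nullP f0 /L2nullP g0; apply/L2nullP.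
by apply: filterS2 f0 g0 => t f0 g0; rewrite L2funBE f0 g0 subrr.
Qed.

HB.instance Definition _ :=
  GRing.isZmodClosed.Build L2fun L2null L2null_zmod_closed.

(* Square-integrable functions modulo equality mu-almost everywhere. *)
Definition L2 : Type := Quotient.quot L2null.
HB.instance Definition _ := GRing.Zmodule.on L2.
HB.instance Definition _ := EqQuotient.on L2.

Definition toL2 (f : L2fun) : L2 := \pi_L2 f.
Definition ofL2 (x : L2) : L2fun := repr x.

Lemma toL2P (f g : L2fun) :
  toL2 f = toL2 g <-> {ae mu, forall t, f t = g t}.
Proof.
rewrite /toL2; split => [/eqP|fg].
  rewrite -Quotient.idealrBE => /L2nullP; apply: filterS => t.
  by rewrite L2funBE => /eqP; rewrite subr_eq0 => /eqP.
apply/eqP; rewrite -Quotient.idealrBE; apply/L2nullP.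
by apply: filterS fg => t fg; rewrite L2funBE fg subrr.
Qed.

Lemma ofL2K x : toL2 (ofL2 x) = x.
Proof. exact: reprK. Qed.

Lemma toL2K (f : L2fun) : {ae mu, forall t, ofL2 (toL2 f) t = f t}.
Proof. by apply/toL2P; rewrite ofL2K. Qed.

Lemma toL2D (f g : L2fun) : toL2 (f + g) = toL2 f + toL2 g.
Proof. by rewrite /toL2 !piE. Qed.

Definition L2scale (a : R[i]) (x : L2) : L2 := toL2 (a *: ofL2 x).

Lemma L2scaleE a (f : L2fun) : L2scale a (toL2 f) = toL2 (a *: f).
Proof. by apply/toL2P; apply: filterS (toL2K f) => t tE; rewrite !L2funZE tE. Qed.

Fact L2scaleA a b x : L2scale a (L2scale b x) = L2scale (a * b) x.
Proof. by rewrite -[x]ofL2K !L2scaleE scalerA. Qed.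
Fact L2scale1 : left_id 1 L2scale.
Proof. by move=> x; rewrite -[x]ofL2K L2scaleE scale1r. Qed.
Fact L2scaleDr : right_distributive L2scale +%R.
Proof.
by move=> a x y; rewrite -[x]ofL2K -[y]ofL2K -toL2D !L2scaleE scalerDr toL2D.
Qed.
Fact L2scaleDl x : {morph L2scale^~ x : a b / a + b}.
Proof. by move=> a b; rewrite -[x]ofL2K !L2scaleE scalerDl toL2D. Qed.

HB.instance Definition _ := GRing.Zmodule_isLmodule.Build R[i] L2
  L2scaleA L2scale1 L2scaleDr L2scaleDl.

Lemma toL2Z a (f : L2fun) : toL2 (a *: f) = a *: toL2 f.
Proof. by rewrite -L2scaleE. Qed.

Lemma toL20 : toL2 0 = 0.
Proof. by have := toL2Z 0 0; rewrite !scale0r. Qed.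

Lemma L2fun_sqr_integrable (f : L2fun) : sqr_integrable f.
Proof. exact/L2predP/L2funP. Qed.

Lemma L2norm_ae f g : measurablec f -> measurablec g ->
  {ae mu, forall t, f t = g t} -> L2norm f = L2norm g.
Proof.
move=> mf mg fg; rewrite /L2norm /Rintegral; congr (Num.sqrt (fine _)).
apply: ae_eq_integral => //; [exact: measurable_normc2..|].
by apply: filterS fg => t -> _.
Qed.

Lemma Lnorm2E (m : T -> R) : (forall t, 0 <= m t) ->
  Lnorm mu 2%:E (EFin \o m) = ((\int[mu]_t (m t ^+ 2)%:E) `^ 2^-1)%E.
Proof.
move=> m0; rewrite unlock; congr (_ `^ _)%E.
by apply: eq_integral => t _; rewrite /= ger0_norm// powR_mulrn.
Qed.

Lemma L2norm_Lnorm f : sqr_integrable f ->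
  (L2norm f)%:E = Lnorm mu 2%:E (EFin \o (fun t => normc (f t))).
Proof.
move=> [mf If]; rewrite Lnorm2E; last by move=> t; exact: normc_ge0.
have /fineK <- := integrable_fin_num measurableT If.
rewrite poweR_EFin powR12_sqrt// fine_ge0// integral_ge0// => t _.
by rewrite lee_fin exprn_ge0 ?normc_ge0.
Qed.

Lemma ler_L2normD f g : sqr_integrable f -> sqr_integrable g ->
  L2norm (f + g) <= L2norm f + L2norm g.
Proof.
move=> hf hg; have hfg := sqr_integrableD hf hg.
rewrite -lee_fin EFinD !L2norm_Lnorm//.
have mf := measurable_normc hf.1; have mg := measurable_normc hg.1.
have m12 : (1 <= 2 :> R) by rewrite ler1n.
apply: le_trans (minkowski_EFin mu mf mg m12).
have n0 h t : 0 <= normc (h t : R[i]) by exact: normc_ge0.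
rewrite (Lnorm2E (n0 _ _)) (@Lnorm2E (_ \+ _)%R); last first.
  by move=> t; rewrite addr_ge0 ?n0.
apply: gt0_ler_poweR.
- by rewrite invr_ge0.
- rewrite in_itv /= leey andbT; apply: integral_ge0 => t _.
  by rewrite lee_fin exprn_ge0 ?n0.
- rewrite in_itv /= leey andbT; apply: integral_ge0 => t _.
  by rewrite lee_fin exprn_ge0 ?addr_ge0 ?n0.
apply: ge0_le_integral.
- exact: measurableT.
- by move=> t _; rewrite lee_fin exprn_ge0 ?n0.
- exact: measurable_normc2 hfg.1.
- by apply/measurable_EFinP/measurable_funX/measurable_funD.
move=> t _; rewrite lee_fin lerXn2r ?nnegrE ?addr_ge0 ?normc_ge0//.
exact: ler_normcD.
Qed.

Lemma L2normZ a f : sqr_integrable f -> L2norm (a *: f) = normc a * L2norm f.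
Proof.
move=> [mf If]; rewrite /L2norm.
rewrite (_ : (fun t => _) = (fun t => normc a ^+ 2 * normc (f t) ^+ 2)); last first.
  by apply/funext => t; rewrite -exprMn -Normc.normcM.
rewrite RintegralZl// sqrtrM ?sqr_ge0// sqrtr_sqr ger0_norm ?normc_ge0//.
Qed.

Lemma L2norm_eq0 f : sqr_integrable f -> L2norm f = 0 ->
  {ae mu, forall t, f t = 0}.
Proof.
move=> hf n0; have : (L2norm f)%:E = 0%E by rewrite n0.
rewrite L2norm_Lnorm// => f0.
have mf : measurable_fun setT (EFin \o (fun t => normc (f t))).
  by apply/measurable_EFinP/measurable_normc; exact: hf.1.
have := Lnorm_eq0_eq0 mf (lte0n 2) f0.
by apply: filterS => t /(_ I) [] /Normc.eq0_normc.
Qed.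

Definition normL2 (x : L2) : R[i] := (L2norm (ofL2 x))%:C.

Lemma normL2E (f : L2fun) : normL2 (toL2 f) = (L2norm f)%:C.
Proof.
congr (_%:C); apply: L2norm_ae; last exact: toL2K.
  by case: (L2fun_sqr_integrable (ofL2 (toL2 f))).
by case: (L2fun_sqr_integrable f).
Qed.

Fact ler_normL2D x y : normL2 (x + y) <= normL2 x + normL2 y.
Proof.
rewrite -[x]ofL2K -[y]ofL2K -toL2D !normL2E -rmorphD lecR.
exact: ler_L2normD (L2fun_sqr_integrable _) (L2fun_sqr_integrable _).
Qed.

Fact normL2Z a x : normL2 (a *: x) = `|a| * normL2 x.
Proof.
rewrite -[x]ofL2K -toL2Z !normL2E (L2normZ _ (L2fun_sqr_integrable _)) rmorphM.
by congr (_ * _); case: a.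
Qed.

Fact normL2_eq0 x : normL2 x = 0 -> x = 0.
Proof.
move=> [] /L2norm_eq0-/(_ (L2fun_sqr_integrable _)) x0.
by rewrite -[x]ofL2K -toL20; apply/toL2P.
Qed.

HB.instance Definition _ := Lmodule_isNormed.Build R[i] L2
  ler_normL2D normL2Z normL2_eq0.

Definition dotL2 (x y : L2) : R[i] := L2dot (ofL2 x) (ofL2 y).

(* Functions, not classes: multiplication on [L2] only depends on the function
   up to equality almost everywhere. *)
Record Linf := MkLinf { Linf_val :> T -> R[i]; LinfP : ess_bounded Linf_val }.

Fact mulL2_subproof (f : Linf) (x : L2) : (fun t => f t * ofL2 x t) \in L2pred.
Proof.
apply/L2predP; exact: sqr_integrableM (LinfP f) (L2fun_sqr_integrable _).
Qed.

Definition mulL2 (f : Linf) (x : L2) : L2 := toL2 (MkL2fun (mulL2_subproof f x)).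

End ComplexL2.

Section LinearSpan.
Context (K : numFieldType) (V : normedModType K).

Definition lspan (E : set V) : set V :=
  [set v | exists n (c : 'I_n -> K) (e : 'I_n -> V),
     (forall i, E (e i)) /\ v = \sum_(i < n) c i *: e i].

Lemma lspan_submod_closed E : submod_closed (mem (lspan E)).
Proof.
split=> [|a u v].
  rewrite inE; exists 0%N, (fun _ => 0), (fun _ => 0); split; first by case.
  by rewrite big_ord0.
rewrite !inE => -[m [c [e [Ee ->]]]] [n [c' [e' [Ee' ->]]]].
exists (m + n)%N, (fun i => match fintype.split i with inl j => a * c j | inr j => c' j end),
  (fun i => match fintype.split i with inl j => e j | inr j => e' j end); split.
  by move=> i; case: (fintype.split i).
rewrite big_split_ord /= scaler_sumr; congr (_ + _); apply: eq_bigr => i _.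
  have -> : fintype.split (lshift n i) = inl i by exact: (unsplitK (inl i)).
  by rewrite scalerA.
by have -> : fintype.split (rshift m i) = inr i by exact: (unsplitK (inr i)).
Qed.

Definition closed_lspan (E : set V) : set V := closure (lspan E).

Lemma closureP_norm (A : set V) v : closure A v <->
  forall e : K, 0 < e -> exists2 w, A w & `|v - w| < e.
Proof.
split=> [Av e e0|Av B /nbhs_ballP[e /= e0 Be]].
  have [w [Aw vw]] := Av _ (nbhsx_ballx v e e0); exists w => //.
  by move: vw; rewrite -ball_normE.
have [w Aw vw] := Av e e0; exists w; split => //; apply: Be.
by rewrite -ball_normE.
Qed.

Lemma closed_lspan_submod_closed E : submod_closed (mem (closed_lspan E)).
Proof.
have [l0 lD] := lspan_submod_closed E.
split=> [|a u v]; rewrite !inE; first by apply: subset_closure; rewrite inE in l0.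
move=> /closureP_norm cu /closureP_norm cv; apply/closureP_norm => e e0.
have a1 : 0 < `|a| + 1 by rewrite ltr_wpDl.
have [u' Eu uu] := cu (e / 2 / (`|a| + 1)) (divr_gt0 (divr_gt0 e0 (ltr0Sn _ 1)) a1).
have [v' Ev vv] := cv (e / 2) (divr_gt0 e0 (ltr0Sn _ 1)).
exists (a *: u' + v').
  by apply: set_mem; apply: lD; exact: mem_set.
rewrite opprD addrACA -scalerBr (splitr e) (le_lt_trans (ler_normD _ _))//.
rewrite ler_ltD// normrZ; apply: le_trans (_ : (`|a| + 1) * `|u - u'| <= _).
  by rewrite ler_wpM2r// lerDl.
by rewrite mulrC -ler_pdivlMr// ltW.
Qed.

End LinearSpan.

Section HardySpace.
Variable R : realType.

Fact twopi_gt0 : 0 < 2 * pi :> R.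
Proof. by rewrite mulr_gt0// pi_gt0. Qed.

(* The unit circle is parameterized by the angle t in [0, 2 pi]: a function f on
   the circle is represented by t |-> f (e^(it)), and normalized arc length by
   the uniform probability on [0, 2 pi].  Values of the representative outside
   [0, 2 pi] are irrelevant, this set being theta-negligible. *)
Definition theta := uniform_prob twopi_gt0.

Definition zcirc (t : R) : R[i] := cos t +i* sin t.

Lemma measurablec_zcirc : measurablec zcirc.
Proof.
split; apply: continuous_measurable_fun; first exact: continuous_cos.
exact: continuous_sin.
Qed.

Lemma normc_zcirc t : normc (zcirc t) = 1.
Proof. by rewrite /= cos2Dsin2 sqrtr1. Qed.

Lemma ess_bounded_zcirc : ess_bounded theta zcirc.
Proof.
split; first exact: measurablec_zcirc.
by exists 1; apply: aeW => t; rewrite normc_zcirc.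
Qed.

Lemma sqr_integrable1 : sqr_integrable theta 1.
Proof.
split; first exact: measurablec_cst.
rewrite (_ : (fun _ => _) = cst 1%E); last first.
  by apply/funext => t; rewrite fctE Normc.normc1 expr1n.
exact: finite_measure_integrable_cst.
Qed.

Fact zpow_subproof n : (fun t => zcirc t ^+ n) \in L2pred theta.
Proof.
apply/L2predP; elim: n => [|n IH]; first exact: sqr_integrable1.
have -> : (fun t => zcirc t ^+ n.+1) = zcirc * (fun t => zcirc t ^+ n).
  by apply/funext => t; rewrite exprS.
exact: sqr_integrableM ess_bounded_zcirc IH.
Qed.

Definition zpow n : L2 theta := toL2 (MkL2fun (zpow_subproof n)).

Definition H2pred : {pred L2 theta} := mem (closed_lspan (range zpow)).

HB.instance Definition _ := GRing.isSubmodClosed.Build R[i] (L2 theta) H2pred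
  (closed_lspan_submod_closed (range zpow)).

Record H2 := MkH2 { H2val :> L2 theta; H2P : H2val \in H2pred }.
HB.instance Definition _ := [isSub for H2val].
HB.instance Definition _ := [Choice of H2 by <:].
HB.instance Definition _ := [SubChoice_isSubLmodule of H2 by <:].

Definition normH2 (h : H2) : R[i] := `|H2val h|.

Fact ler_normH2D x y : normH2 (x + y) <= normH2 x + normH2 y.
Proof. exact: ler_normD. Qed.
Fact normH2Z a x : normH2 (a *: x) = `|a| * normH2 x.
Proof. exact: normrZ. Qed.
Fact normH2_eq0 x : normH2 x = 0 -> x = 0.
Proof. by move=> /normr0_eq0 x0; apply: val_inj. Qed.

HB.instance Definition _ := Lmodule_isNormed.Build R[i] H2
  ler_normH2D normH2Z normH2_eq0.

(* Orthogonal projection: the h in H2 such that g - h is orthogonal to H2.  Such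
   an h exists and is unique, so the default value 0 is never used. *)
Definition projH2 (g : L2 theta) : H2 :=
  xget 0 [set h : H2 | forall k : H2, dotL2 (g - H2val h) (H2val k) = 0].

Definition toeplitz (f : Linf theta) (h : H2) : H2 := projH2 (mulL2 f (H2val h)).

Fact ess_bounded_zbar : ess_bounded theta (fun t => (zcirc t)^*%C).
Proof.
split; first exact/measurablec_conj/measurablec_zcirc.
exists 1; apply: aeW => t; have := normc_zcirc t.
by rewrite /= sqrrN => ->.
Qed.

Definition zbar : Linf theta := MkLinf ess_bounded_zbar.

Fact ess_bounded_one_plus_z b : ess_bounded theta (fun t => 1 + b * zcirc t).
Proof.
split.
  apply: (@measurablecD _ _ _ (cst 1) (cst b * zcirc)).
    exact: measurablec_cst.
  by apply: measurablecM; [exact: measurablec_cst|exact: measurablec_zcirc].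
exists (1 + normc b); apply: aeW => t; apply: le_trans (ler_normcD _ _) _.
by rewrite Normc.normc1 Normc.normcM normc_zcirc mulr1.
Qed.

Definition one_plus_z b : Linf theta := MkLinf (ess_bounded_one_plus_z b).

End HardySpace.

Section Operators.
Context (R : realType) (V : normedModType R[i]).
Implicit Types A B : V -> V.
Local Open Scope ereal_scope.

Definition bounded_op A :=
  linear A /\ exists M : R, forall x, (`|A x| <= M%:C * `|x|)%R.

(* Norms on V take values in R[i], hence the real part. *)
Definition opnorm A : \bar R :=
  ereal_sup [set (complex.Re `|A x|)%:E | x in [set x | (`|x| <= 1)%R]].

Definition is_inverse A B := [/\ bounded_op B, cancel A B & cancel B A].

(* The bounded inverse of an operator, and the zero operator by convention if
   there is none. *)
Definition op_inv A : V -> V := xget (cst 0%R) [set B | is_inverse A B].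

Definition scalar_sub (l : R[i]) A : V -> V := fun x => (l *: x - A x)%R.

Definition spectrum A : set R[i] :=
  [set l | ~ exists B, is_inverse (scalar_sub l A) B].

(* The distance to the empty set is +oo. *)
Definition dist (l : R[i]) (S : set R[i]) : \bar R :=
  ereal_inf [set (normc (l - m))%:E | m in S].

Definition power_bound A : \bar R := ereal_sup [set opnorm (iter n A) | n in setT].

(* Meaningful when the spectrum of A is contained in the closed unit disk, which
   is in particular the case when A is a bounded operator on a Banach space and
   [power_bound A] is finite. *)
Definition resolvent_bound A : \bar R :=
  ereal_sup [set dist l (spectrum A) * opnorm (op_inv (scalar_sub l A))
            | l in [set l | (1 < normc l)%R]].

End Operators.

(* Main.v *)
Require Import Defs.
From mathcomp Require Import all_boot all_order all_algebra.
From mathcomp Require Import all_classical all_reals all_analysis.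
From mathcomp Require Import complex.
From mathcomp Require Import measurable_realfun uniform_distribution ring lra.
Import Order.TTheory GRing.Theory Num.Theory.
Import numFieldNormedType.Exports.
Local Open Scope ring_scope.

(** Write [S] for the backward shift [h |-> (h - h(0)) / z] on the Hardy space;
    it is the Toeplitz operator of the conjugate of [z].  The Toeplitz operator
    of [1 + b z] is multiplication by [1 + b z], and conjugating [S] by it gives
    a rank one perturbation
      [A h = S h + b h(0) u],  with [u = 1 / (1 + b z)].
    Here [S u = - b u] and [u(0) = 1], so [A u = 0], and the norm of [u] is
    [N = 1 / sqrt (1 - |b|^2)].

    Powers.  Since [A u = 0], [A^(n+1) = A S^n], so that [M(A)] is the larger of
    [1] and [|A|].  The triangle inequality gives [|A| <= 1 + |b| N], and
    [A 1 = b u] gives [|A| >= |b| N] ([power_bound_le], [power_bound_ge]).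

    Resolvent.  For [|l| > 1] let [G] be the inverse of [l - S].  Then
    [(l - A)^-1 h = G h + (b / l) (G h)(0) u].  The norm of [G h] is at most
    [|h| / (|l| - 1)], and [(G h)(0) = h(1/l) / l] is the scalar product of [h]
    with a multiple of the Szego kernel [1 / (1 - w z)], [w] the conjugate of
    [1/l], hence has modulus at most [|h| / sqrt (|l|^2 - 1)].  The spectrum of
    [A] is dense in the unit disk and contained in the closed disk, so its
    distance to [l] is [|l| - 1].  With [r = |l|] this yields
      [P(A) <= 1 + sup_(r > 1) (r - 1) / (r sqrt (r^2 - 1)) |b| N],
    and the supremum is attained at the golden ratio, where it is the constant
    of the statement ([rate_le], [rate_golden]).  The identity
    [(l - A)^-1 = (1 + A G) / l] gives [P(A) <= M(A)].

    Lower bounds for [P(A)].  The vector [u] satisfies [(l - A)^-1 u = u / l],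
    and letting [l] tend to infinity gives [P(A) >= 1].  For the other bound
    take [|l|] to be the golden ratio and the argument of [l] such that [b / l]
    is positive; the resolvent maps a multiple of the kernel [k] above to
    [k + (b / l) u], whose norm is at least that of [(b / l) u], because the
    scalar product of [k] and [u] is positive ([resolvent_bound_ge_const]).

    Only orthogonality of the [z^n] with [n > 0] to the constants requires
    computing an integral.  Inverses are multiplications by explicit bounded
    functions, so no completeness argument is needed; that they preserve the
    Hardy space is [H2pred_fixpoint]. *)

Set Implicit Arguments.
Unset Strict Implicit.
Unset Printing Implicit Defensive.
Local Open Scope classical_set_scope.
Local Open Scope ring_scope.
Local Open Scope complex_scope.

(** * Complex numbers, real-valued norms and the scalar product of L2 *)

Section ComplexFacts.
Variable R : realType.
Implicit Types x y z : R[i].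

Lemma normc_conj z : normc z^*%C = normc z.
Proof. by case: z => a b /=; rewrite sqrrN. Qed.

Lemma mulc_conj z : z * z^*%C = (normc z ^+ 2)%:C.
Proof.
case: z => a b; rewrite normcE2 /=; apply/eqP; rewrite eq_complex /=.
by apply/andP; split; apply/eqP; ring.
Qed.

Lemma normc_subr_ge x y : normc x - normc y <= normc (x - y).
Proof.
have := ler_normcD (x - y) y; rewrite subrK; lra.
Qed.

Lemma normc_gt0 z : z != 0 -> 0 < normc z.
Proof.
move=> z0; rewrite lt_neqAle normc_ge0 andbT eq_sym; apply: contra_neq z0.
exact: Normc.eq0_normc.
Qed.

Lemma normcV z : normc z^-1 = (normc z)^-1.
Proof.
have [->|z0] := eqVneq z 0; first by rewrite invr0 Normc.normc0 invr0.
have n0 : normc z != 0 by rewrite gt_eqF ?normc_gt0.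
by apply: (mulfI n0); rewrite -Normc.normcM divff// divff// Normc.normc1.
Qed.

Lemma normcN z : normc (- z) = normc z.
Proof. by case: z => a b /=; rewrite !sqrrN. Qed.

Lemma normcR (r : R) : normc r%:C = `|r|.
Proof. by rewrite /= expr0n addr0 sqrtr_sqr. Qed.

Lemma normrE_normc z : `|z| = (normc z)%:C.
Proof. by case: z. Qed.

Lemma addcE (a b c e : R) : (a +i* b) + (c +i* e) = (a + c) +i* (b + e).
Proof. by []. Qed.

Lemma mulcE (a b c e : R) :
  (a +i* b) * (c +i* e) = (a * c - b * e) +i* (a * e + b * c).
Proof. by []. Qed.

Lemma conjcE (a b : R) : (a +i* b)^*%C = a +i* (- b).
Proof. by []. Qed.

Lemma conjcD x y : (x + y)^*%C = x^*%C + y^*%C.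
Proof. exact: rmorphD. Qed.

Lemma conjcN x : (- x)^*%C = - x^*%C.
Proof. exact: rmorphN. Qed.

Lemma conjcM x y : (x * y)^*%C = x^*%C * y^*%C.
Proof. exact: rmorphM. Qed.

Lemma rcD (r s : R) : (r + s)%:C = r%:C + s%:C.
Proof. exact: rmorphD. Qed.

Lemma rcM (r s : R) : (r * s)%:C = r%:C * s%:C.
Proof. exact: rmorphM. Qed.

End ComplexFacts.

Section RealNorm.
Context (R : realType) (V : normedModType R[i]).
Implicit Types x y : V.

(** The norm of a complex normed space, as a real number. *)
Definition rnorm x : R := complex.Re `|x|.

Lemma rnormE x : `|x| = (rnorm x)%:C.
Proof.
have := normr_ge0 x; rewrite /rnorm; case: `|x| => a c /=.
by rewrite lecE /= => /andP[/eqP-> _].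
Qed.

Lemma rnorm_ge0 x : 0 <= rnorm x.
Proof. by have := normr_ge0 x; rewrite rnormE -[X in X <= _]/(0%:C) lecR. Qed.

Lemma rnormD x y : rnorm (x + y) <= rnorm x + rnorm y.
Proof. by rewrite -lecR rcD -!rnormE; exact: ler_normD. Qed.

Lemma rnormZ a x : rnorm (a *: x) = normc a * rnorm x.
Proof.
by apply: complexI; rewrite rcM -!rnormE normrZ normrE_normc.
Qed.

Lemma rnorm0 : rnorm 0 = 0.
Proof. by apply: complexI; rewrite -rnormE normr0. Qed.

Lemma rnormN x : rnorm (- x) = rnorm x.
Proof. by apply: complexI; rewrite -!rnormE normrN. Qed.

Lemma rnorm_eq0 x : rnorm x = 0 -> x = 0.
Proof. by move=> x0; apply/normr0_eq0; rewrite rnormE x0. Qed.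

Lemma rnorm_gt0 x : x != 0 -> 0 < rnorm x.
Proof.
move=> x0; rewrite lt_neqAle rnorm_ge0 andbT eq_sym; apply: contra_neq x0.
exact: rnorm_eq0.
Qed.

Lemma rnorm_lt x (r : R) : (`|x| < r%:C) = (rnorm x < r).
Proof. by rewrite rnormE ltcR. Qed.

End RealNorm.

Section InnerProduct.
Context d (T : measurableType d) (R : realType).
Variable mu : {measure set T -> \bar R}.
Implicit Types (f g : T -> R[i]) (x y : L2 mu).

(** Both parts of [f * conj g] are dominated by [|f|^2 + |g|^2]. *)
Lemma sqr_integrable_mulc f g : sqr_integrable mu f -> sqr_integrable mu g ->
  mu.-integrable setT (fun t => (complex.Re (f t * (g t)^*%C))%:E) /\
  mu.-integrable setT (fun t => (complex.Im (f t * (g t)^*%C))%:E).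
Proof.
move=> [mf If] [mg Ig].
have [mr mi] := measurablecM mf (measurablec_conj mg).
have Ifg := integrableD measurableT If Ig.
have H (h : T -> R) : measurable_fun setT h ->
    (forall t, `|h t| <= normc (f t) ^+ 2 + normc (g t) ^+ 2) ->
    mu.-integrable setT (EFin \o h).
  move=> mh hfg; apply: le_integrable Ifg => //; first exact/measurable_EFinP.
  move=> t _ /=; rewrite lee_fin (ger0_norm (addr_ge0 _ _)) ?sqr_ge0//.
split; apply: H => // t; rewrite ler_norml.
  case: (f t) (g t) => a b [c e]; rewrite !normcE2 /=.
  by apply/andP; split; have := sqr_ge0 (a - c); have := sqr_ge0 (a + c);
    have := sqr_ge0 (b - e); have := sqr_ge0 (b + e); nra.
case: (f t) (g t) => a b [c e]; rewrite !normcE2 /=.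
by apply/andP; split; have := sqr_ge0 (a - e); have := sqr_ge0 (a + e);
  have := sqr_ge0 (b - c); have := sqr_ge0 (b + c); nra.
Qed.

Lemma L2dot_ae f g f' g' : measurablec f -> measurablec g ->
    measurablec f' -> measurablec g' ->
    {ae mu, forall t, f t = f' t} -> {ae mu, forall t, g t = g' t} ->
  L2dot mu f g = L2dot mu f' g'.
Proof.
move=> mf mg mf' mg' ff gg; rewrite /L2dot /Rintegral.
have [mr mi] := measurablecM mf (measurablec_conj mg).
have [mr' mi'] := measurablecM mf' (measurablec_conj mg').
congr (fine _ +i* fine _); apply: ae_eq_integral => //.
- exact/measurable_EFinP.
- exact/measurable_EFinP.
- by apply: filterS2 ff gg => t -> ->.
- exact/measurable_EFinP.
- exact/measurable_EFinP.
- by apply: filterS2 ff gg => t -> ->.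
Qed.

Lemma dotL2E (f g : L2fun mu) : dotL2 (toL2 f) (toL2 g) = L2dot mu f g.
Proof.
apply: L2dot_ae; try exact: (L2fun_sqr_integrable _).1; exact: toL2K.
Qed.

Lemma L2_ext (f g : L2fun mu) : (forall t, f t = g t) -> toL2 f = toL2 g.
Proof. by move=> fg; apply/toL2P; exact: aeW. Qed.

Lemma dotL2Dl x y z : dotL2 (x + y) z = dotL2 x z + dotL2 y z.
Proof.
rewrite -[x]ofL2K -[y]ofL2K -[z]ofL2K -toL2D !dotL2E.
set f := ofL2 x; set g := ofL2 y; set h := ofL2 z.
have [fr fi] := sqr_integrable_mulc (L2fun_sqr_integrable f) (L2fun_sqr_integrable h).
have [gr gi] := sqr_integrable_mulc (L2fun_sqr_integrable g) (L2fun_sqr_integrable h).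
rewrite /L2dot addcE -!RintegralD//.
congr (_ +i* _); apply: eq_Rintegral => t _; rewrite L2funDE mulrDl.
  by case: (f t * _) (g t * _) => ? ? [].
by case: (f t * _) (g t * _) => ? ? [].
Qed.

Lemma dotL2Zl a x y : dotL2 (a *: x) y = a * dotL2 x y.
Proof.
rewrite -[x]ofL2K -[y]ofL2K -toL2Z !dotL2E.
set f := ofL2 x; set g := ofL2 y.
have [fr fi] := sqr_integrable_mulc (L2fun_sqr_integrable f) (L2fun_sqr_integrable g).
case: a => a c; rewrite /L2dot mulcE -!RintegralZl//.
rewrite -RintegralB//; [|exact: (integrableZl measurableT _ fr)
                        |exact: (integrableZl measurableT _ fi)].
rewrite -RintegralD//; [|exact: (integrableZl measurableT _ fi)
                        |exact: (integrableZl measurableT _ fr)].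
congr (_ +i* _); apply: eq_Rintegral => t _.
  by rewrite L2funZE; case: (f t) (g t) => ? ? [? ?] /=; ring.
by rewrite L2funZE; case: (f t) (g t) => ? ? [? ?] /=; ring.
Qed.

Lemma dotL2_conj x y : dotL2 y x = (dotL2 x y)^*%C.
Proof.
rewrite -[x]ofL2K -[y]ofL2K !dotL2E.
set f := ofL2 x; set g := ofL2 y.
have [fr fi] := sqr_integrable_mulc (L2fun_sqr_integrable f) (L2fun_sqr_integrable g).
rewrite /L2dot [RHS]conjcE -mulN1r -RintegralZl//.
congr (_ +i* _); apply: eq_Rintegral => t _.
  by case: (f t) (g t) => ? ? [? ?] /=; ring.
by case: (f t) (g t) => ? ? [? ?] /=; ring.
Qed.

Lemma rnorm_toL2 (f : L2fun mu) : rnorm (toL2 f) = L2norm mu f.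
Proof. exact: (congr1 (@complex.Re R) (normL2E f)). Qed.

Lemma dotL2_norm x : dotL2 x x = (rnorm x ^+ 2)%:C.
Proof.
rewrite -[x]ofL2K dotL2E rnorm_toL2 /L2norm sqr_sqrtr; last first.
  by apply: Rintegral_ge0 => t _; exact: sqr_ge0.
rewrite /L2dot; apply/eqP; rewrite eq_complex /=; apply/andP; split; apply/eqP.
  by apply: eq_Rintegral => t _; rewrite mulc_conj.
rewrite (@eq_Rintegral _ _ _ mu setT (cst 0)) => [|t _]; last by rewrite mulc_conj.
by rewrite /Rintegral integral0.
Qed.

Lemma dotL20l y : dotL2 0 y = 0.
Proof. by have := dotL2Zl 0 0 y; rewrite scale0r mul0r. Qed.

Lemma dotL2Bl x y z : dotL2 (x - y) z = dotL2 x z - dotL2 y z.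
Proof. by rewrite -scaleN1r dotL2Dl dotL2Zl mulN1r. Qed.

Lemma dotL2Dr x y z : dotL2 x (y + z) = dotL2 x y + dotL2 x z.
Proof. by rewrite dotL2_conj dotL2Dl conjcD -!dotL2_conj. Qed.

Lemma dotL2Zr a x y : dotL2 x (a *: y) = a^*%C * dotL2 x y.
Proof. by rewrite dotL2_conj dotL2Zl conjcM -dotL2_conj. Qed.

Lemma dotL2Br x y z : dotL2 x (y - z) = dotL2 x y - dotL2 x z.
Proof. by rewrite dotL2_conj dotL2Bl conjcD conjcN -!dotL2_conj. Qed.

Lemma rnormD_sqr x y :
  rnorm (x + y) ^+ 2 = rnorm x ^+ 2 + rnorm y ^+ 2 + complex.Re (dotL2 x y) *+ 2.
Proof.
apply: complexI; rewrite -dotL2_norm dotL2Dl !dotL2Dr [dotL2 y x]dotL2_conj.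
rewrite !dotL2_norm; case: (dotL2 x y) => a b; apply/eqP.
by rewrite eq_complex /= mulr2n; apply/andP; split; apply/eqP; ring.
Qed.

Lemma cauchy_schwarz x y : normc (dotL2 x y) <= rnorm x * rnorm y.
Proof.
have [->|y0] := eqVneq y 0.
  by rewrite dotL2_conj dotL20l normc_conj rnorm0 Normc.normc0 mulr0.
have ny := rnorm_gt0 y0.
(* expand the squared norm of |y|^2 x - <x, y> y, a multiple of the component
   of x orthogonal to y *)
pose n := rnorm y ^+ 2.
have n0 : 0 < n by rewrite exprn_gt0.
have := sqr_ge0 (rnorm (n%:C *: x + (- dotL2 x y) *: y)).
have -> : rnorm (n%:C *: x + (- dotL2 x y) *: y) ^+ 2 =
    n * (n * rnorm x ^+ 2 - normc (dotL2 x y) ^+ 2).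
  have dE : dotL2 (n%:C *: x) (- dotL2 x y *: y) = - (n * normc (dotL2 x y) ^+ 2)%:C.
    by rewrite dotL2Zl dotL2Zr conjcN rcM -mulc_conj; ring.
  rewrite rnormD_sqr !rnormZ dE normcN normcR ger0_norm ?ltW// !exprMn -/n /=.
  by rewrite mulr2n; ring.
rewrite pmulr_rge0// subr_ge0 => h.
rewrite -[_ <= _]ler_sqr ?nnegrE ?mulr_ge0 ?normc_ge0 ?rnorm_ge0//.
by rewrite exprMn -/n mulrC.
Qed.

Implicit Types m : Linf mu.

Lemma mulL2E m (f g : L2fun mu) : (forall t, g t = m t * f t) ->
  mulL2 m (toL2 f) = toL2 g.
Proof.
move=> gE; apply/toL2P; apply: filterS (toL2K f) => t tE.
by rewrite gE /= tE.
Qed.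

Lemma mulL2D m x y : mulL2 m (x + y) = mulL2 m x + mulL2 m y.
Proof.
rewrite -[x]ofL2K -[y]ofL2K -toL2D.
rewrite (mulL2E (g := MkL2fun (mulL2_subproof m x) + MkL2fun (mulL2_subproof m y))).
  by rewrite toL2D !ofL2K.
by move=> t; rewrite !L2funDE mulrDr.
Qed.

Lemma mulL2Z m a x : mulL2 m (a *: x) = a *: mulL2 m x.
Proof.
rewrite -[x]ofL2K -toL2Z.
rewrite (mulL2E (g := a *: MkL2fun (mulL2_subproof m x))).
  by rewrite toL2Z !ofL2K.
by move=> t; rewrite !L2funZE mulrCA.
Qed.

Lemma mulL20 m : mulL2 m 0 = 0.
Proof. by have := mulL2Z m 0 0; rewrite !scale0r. Qed.

Lemma mulL2B m x y : mulL2 m (x - y) = mulL2 m x - mulL2 m y.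
Proof. by rewrite -scaleN1r mulL2D mulL2Z scaleN1r. Qed.

Lemma mulL2_comp m1 m2 m3 x : (forall t, m1 t * m2 t = m3 t) ->
  mulL2 m1 (mulL2 m2 x) = mulL2 m3 x.
Proof.
move=> m123; apply: (mulL2E (f := MkL2fun (mulL2_subproof m2 x))
  (g := MkL2fun (mulL2_subproof m3 x))) => t /=.
by rewrite -m123 mulrA.
Qed.

Lemma mulL2_id m x : (forall t, m t = 1) -> mulL2 m x = x.
Proof.
move=> m1; rewrite -[RHS]ofL2K.
by apply: L2_ext => t /=; rewrite m1 mul1r.
Qed.

(** Multiplication operators depend affinely on the multiplier; stated
    pointwise since multipliers are functions and carry no algebraic
    structure. *)
Lemma mulL2_affine m1 m2 a b x : (forall t, m1 t = a + b * m2 t) ->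
  mulL2 m1 x = a *: x + b *: mulL2 m2 x.
Proof.
move=> mE; rewrite -{2}(ofL2K x) -toL2Z /mulL2 -toL2Z -toL2D; apply: L2_ext => t.
by rewrite L2funDE !L2funZE /= mE mulrDl mulrA.
Qed.

(** The adjoint of a multiplication is the multiplication by the conjugate. *)
Lemma dotL2_mul m1 m2 x y : (forall t, m2 t = (m1 t)^*%C) ->
  dotL2 (mulL2 m1 x) y = dotL2 x (mulL2 m2 y).
Proof.
move=> mE; rewrite -[in LHS](ofL2K y) -[in RHS](ofL2K x) /mulL2 !dotL2E.
rewrite /L2dot; congr (_ +i* _); apply: eq_Rintegral => t _ /=.
  by rewrite mE conjcM conjcK mulrCA mulrA.
by rewrite mE conjcM conjcK mulrCA mulrA.
Qed.

Lemma rnorm_mulL2 m (M : R) x : (forall t, normc (m t) <= M) ->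
  rnorm (mulL2 m x) <= M * rnorm x.
Proof.
move=> mM; set f := ofL2 x.
have [mf If] := L2fun_sqr_integrable f.
have [mg Ig] := L2fun_sqr_integrable (MkL2fun (mulL2_subproof m x)).
have M0 : 0 <= M := le_trans (normc_ge0 _) (mM point).
rewrite -[x in X in _ <= X]ofL2K /mulL2 !rnorm_toL2 /L2norm.
rewrite -[M in X in _ <= X]ger0_norm// -sqrtr_sqr -sqrtrM ?sqr_ge0//.
rewrite -RintegralZl// ler_wsqrtr//; apply: le_Rintegral => //.
  exact: (integrableZl measurableT (M ^+ 2) If).
move=> t _; rewrite Normc.normcM exprMn ler_wpM2r ?sqr_ge0//.
by rewrite lerXn2r ?nnegrE ?normc_ge0.
Qed.

End InnerProduct.

(** * Integrals over the circle and closedness of the Hardy space *)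

Section CircleIntegrals.
Variable R : realType.

(** De Moivre's formula. *)
Lemma zcircX (t : R) n : zcirc t ^+ n = cos (n%:R * t) +i* sin (n%:R * t).
Proof.
elim: n => [|n IH]; first by rewrite mul0r cos0 sin0.
rewrite exprSr IH -natr1 mulrDl mul1r cosD sinD /zcirc mulcE.
by congr (_ +i* _); ring.
Qed.

Lemma zcirc2pi : zcirc (2 * pi) = 1 :> R[i].
Proof. by rewrite mulrC mulr_natr /zcirc cos2pi sin2pi. Qed.

Lemma theta_setT : @theta R setT = 1%E.
Proof. by rewrite /theta probability_setT. Qed.

Lemma theta_integrable_bounded (f : R -> R) : continuous f ->
  (forall t, `|f t| <= 1) -> (@theta R).-integrable setT (EFin \o f).
Proof.
move=> cf f1; have mf := continuous_measurable_fun cf.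
apply: (@le_integrable _ _ _ _ _ measurableT _ (cst 1%:E)).
- exact/measurable_EFinP.
- by move=> t _; rewrite /= lee_fin normr1.
- exact: finite_measure_integrable_cst.
Qed.

(** The integral formula for the uniform law requires a nonnegative integrand;
    [1 + f] is one. *)
Lemma theta_integral_periodic (f F : R -> R) : continuous f ->
    (forall t, `|f t| <= 1) -> (forall t, is_derive t (1 : R) F (f t)) ->
    F (2 * pi) = F 0 ->
  (\int[@theta R]_t f t)%R = 0.
Proof.
move=> cf f1 dF FE; have If := theta_integrable_bounded cf f1.
have cf1 : continuous (fun t => 1 + f t).
  by move=> t; apply: cvgD; [exact: cvg_cst|exact: cf].
have I1 : (\int[@theta R]_t (1 + f t))%R = 1.
  rewrite /Rintegral integral_uniform; last 2 first.
  - apply: (measurableT_comp (f := EFin)); first exact: EFin_measurable.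
    exact: continuous_measurable_fun cf1.
  - by move=> t; rewrite lee_fin; have := f1 t; rewrite ler_norml; lra.
  have dG t : is_derive t (1 : R) (fun x => x + F x) (1 + f t).
    exact: (is_deriveD (is_derive_id t (1 : R)) (dF t)).
  rewrite (@continuous_FTC2 _ _ (fun x => x + F x)).
  - rewrite FE subr0 -EFinB -EFinM /= add0r addrK.
    by rewrite mulVf// gt_eqF// twopi_gt0.
  - exact: twopi_gt0.
  - exact: continuous_subspaceT.
  - have dd t : derivable (fun x => x + F x) t 1 by apply: ex_derive.
    have cc : continuous (fun x => x + F x).
      by move=> t; apply: differentiable_continuous; apply/derivable1_diffP.
    split=> [t _ //||]; first exact: cvg_at_right_filter (cc _).
    exact: cvg_at_left_filter (cc _).
  - by move=> t _; rewrite derive1E; exact: derive_val.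
move: I1; rewrite RintegralD//; last exact: finite_measure_integrable_cst.
rewrite Rintegral_cst// mul1r.
have P1 := theta_setT; rewrite /theta /= in P1 *; rewrite P1.
by move=> /(canRL (addKr _)) ->; rewrite addNr.
Qed.

Lemma is_derive_sin_scale (c t : R) : c != 0 ->
  is_derive t (1 : R) (fun x => sin (c * x) / c) (cos (c * t)).
Proof.
move=> c0.
have dc : is_derive t (1 : R) (fun x : R => c * x) c.
  by rewrite -[X in is_derive _ _ _ X]mulr1; exact: is_deriveZ.
have ds := is_derive1_comp (f := @sin R) (is_derive_sin (c * t)) dc.
have := is_deriveZ c^-1 ds.
rewrite (_ : _ *: _ = cos (c * t)); last by rewrite /GRing.scale /= mulrCA mulVf// mulr1.
have -> // : (fun x => sin (c * x) / c) = c^-1 \*: (@sin R \o *%R c).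
by apply/funext => x; rewrite mulrC.
Qed.

Lemma is_derive_cos_scale (c t : R) : c != 0 ->
  is_derive t (1 : R) (fun x => - cos (c * x) / c) (sin (c * t)).
Proof.
move=> c0.
have dc : is_derive t (1 : R) (fun x : R => c * x) c.
  by rewrite -[X in is_derive _ _ _ X]mulr1; exact: is_deriveZ.
have ds := is_derive1_comp (f := @cos R) (is_derive_cos (c * t)) dc.
have := is_deriveZ (- c^-1) ds.
rewrite (_ : _ *: _ = sin (c * t)); last first.
  by rewrite /GRing.scale /= !mulNr mulrN opprK mulrCA mulVf// mulr1.
have -> // : (fun x => - cos (c * x) / c) = (- c^-1) \*: (@cos R \o *%R c).
by apply/funext => x /=; rewrite /GRing.scale /= !mulNr mulrC.
Qed.

Lemma continuous_comp_scale (g : R -> R) (c : R) : continuous g ->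
  continuous (fun t => g (c * t)).
Proof.
move=> cg t; apply: (@continuous_comp _ _ _ ( *%R c) g); last exact: cg.
exact: mulrl_continuous.
Qed.

Lemma theta_integral_zcircX n :
  (\int[@theta R]_t complex.Re (zcirc t ^+ n.+1))%R = 0 /\
  (\int[@theta R]_t complex.Im (zcirc t ^+ n.+1))%R = 0.
Proof.
have n0 : n.+1%:R != 0 :> R by rewrite pnatr_eq0.
have : zcirc (n.+1%:R * (2 * pi)) = 1 :> R[i].
  by rewrite /zcirc -zcircX zcirc2pi expr1n.
move=> [cn sn]; split; under eq_Rintegral do rewrite zcircX /=.
  apply: (theta_integral_periodic (F := fun x => sin (n.+1%:R * x) / n.+1%:R)).
  - exact: continuous_comp_scale (@continuous_cos R).
  - by move=> t; rewrite ler_norml cos_geN1 cos_le1.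
  - by move=> t; exact: is_derive_sin_scale.
  - by rewrite sn mulr0 sin0.
apply: (theta_integral_periodic (F := fun x => - cos (n.+1%:R * x) / n.+1%:R)).
- exact: continuous_comp_scale (@continuous_sin R).
- by move=> t; rewrite ler_norml sin_geN1 sin_le1.
- by move=> t; exact: is_derive_cos_scale.
- by rewrite cn mulr0 cos0.
Qed.

End CircleIntegrals.

Section HardyL2.
Variable R : realType.
Local Notation L2T := (L2 (@theta R)).
Implicit Types (x y : L2T) (a : R[i]).

(** The Hardy space is closed, in terms of the real-valued norm. *)
Lemma H2pred_closed x :
  (forall e : R, 0 < e -> exists2 y, y \in @H2pred R & rnorm (x - y) < e) ->
  x \in @H2pred R.
Proof.
move=> H; rewrite inE; apply/closureP_norm => e e0.
have eR : e = (complex.Re e)%:C.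
  by case: e e0 => a c; rewrite ltcE /= => /andP[/eqP-> _].
have r0 : 0 < complex.Re e by move: e0; rewrite {1}eR -[X in X < _]/(0%:C) ltcR.
have [y Hy xy] := H _ (divr_gt0 r0 (ltr0Sn _ 1)).
move: Hy; rewrite inE => /closureP_norm Hy.
have e20 : 0 < (complex.Re e / 2)%:C.
  by rewrite -[X in X < _]/(0%:C) ltcR divr_gt0.
have [z Ez yz] := Hy _ e20; exists z => //.
rewrite eR rnorm_lt; rewrite rnorm_lt in yz.
rewrite -(subrK y x) -addrA (le_lt_trans (rnormD _ _))//.
by rewrite [ltRHS]splitr ltrD.
Qed.

(** Density of the span of the powers of [z] in the Hardy space. *)
Lemma H2pred_ind (P : L2T -> Prop) :
    P 0 -> (forall a x y, P x -> P y -> P (a *: x + y)) ->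
    (forall n, P (zpow R n)) ->
    (forall x, (forall e : R, 0 < e -> exists2 y, P y & rnorm (x - y) < e) -> P x) ->
  forall x, x \in @H2pred R -> P x.
Proof.
move=> P0 PL Pz Pcl x; rewrite inE => /closureP_norm Hx; apply: Pcl => e e0.
have e0' : 0 < e%:C by rewrite -[X in X < _]/(0%:C) ltcR.
have [y [n [c [v [Ev ->]]]] xy] := Hx _ e0'.
exists (\sum_(i < n) c i *: v i); last by rewrite -rnorm_lt.
elim: n c v Ev {xy} => [|n IH] c v Ev; first by rewrite big_ord0.
rewrite big_ord_recl; apply: PL; first by have [m _ <-] := Ev ord0.
by apply: IH => i; exact: Ev.
Qed.

Lemma zpow_H2 n : zpow R n \in @H2pred R.
Proof.
apply: H2pred_closed => e e0; exists (zpow R n); last by rewrite subrr rnorm0.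
rewrite inE; apply: subset_closure.
exists 1%N, (fun=> 1), (fun=> zpow R n); split; first by move=> _; exists n.
by rewrite big_ord1 scale1r.
Qed.

Lemma H2pred_map (F : L2T -> L2T) :
    (forall a x y, F (a *: x + y) = a *: F x + F y) ->
    (forall x, rnorm (F x) <= rnorm x) ->
    (forall n, F (zpow R n) \in @H2pred R) ->
  forall x, x \in @H2pred R -> F x \in @H2pred R.
Proof.
move=> FL F1 Fz; apply: H2pred_ind => //.
- have := FL (-1) 0 0; rewrite scaler0 addr0 scaleN1r addNr => ->.
  exact: rpred0.
- by move=> a x y Hx Hy; rewrite FL rpredD// rpredZ.
- move=> x Hx; apply: H2pred_closed => e /Hx[y Hy xy]; exists (F y) => //.
  by rewrite -scaleN1r addrC -FL scaleN1r addrC (le_lt_trans (F1 _)).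
Qed.

(** A solution of [x = y + a F x] in [L2] is in the Hardy space as soon as [y]
    is and the contraction [F] preserves that space: the iterates of
    [x |-> y + a F x] starting from [0] stay in the Hardy space and converge
    geometrically to [x].  Since [x] is given, completeness plays no role. *)
Lemma H2pred_fixpoint (F : L2T -> L2T) a x y :
    (forall x y, F (x - y) = F x - F y) -> (forall x, rnorm (F x) <= rnorm x) ->
    (forall x, x \in @H2pred R -> F x \in @H2pred R) ->
    normc a < 1 -> y \in @H2pred R -> x = y + a *: F x ->
  x \in @H2pred R.
Proof.
move=> FB F1 FH a1 Hy xE.
have approx n : exists2 z, z \in @H2pred R & rnorm (x - z) <= normc a ^+ n * rnorm x.
  elim: n => [|n [z Hz xz]].
    by exists 0; [exact: rpred0|rewrite subr0 mul1r].
  exists (y + a *: F z); first by rewrite rpredD// rpredZ// FH.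
  rewrite {1}xE opprD addrACA subrr add0r -scalerBr -FB rnormZ exprS -mulrA.
  by rewrite ler_wpM2l ?normc_ge0// (le_trans (F1 _)).
apply: H2pred_closed => e e0.
have [x0|x0] := eqVneq x 0; first by exists 0; [exact: rpred0|rewrite x0 subr0 rnorm0].
have [n an] : exists n, normc a ^+ n < e / rnorm x.
  have : normc a ^+ n @[n --> \oo] --> (0 : R).
    by apply: cvg_expr; rewrite ger0_norm ?normc_ge0.
  move=> /cvgrPdist_lt /(_ _ (divr_gt0 e0 (rnorm_gt0 x0))) [n _ /(_ n (leqnn n))].
  by rewrite /= sub0r normrN ger0_norm ?exprn_ge0 ?normc_ge0//; exists n.
have [z Hz xz] := approx n; exists z => //.
by rewrite (le_lt_trans xz)// -ltr_pdivlMr// rnorm_gt0.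
Qed.

End HardyL2.

(** * Shifts, Szego kernels and the resolvent of the backward shift *)

Section Shifts.
Variable R : realType.
Local Notation L2T := (L2 (@theta R)).
Local Notation H2p := (@H2pred R).
Implicit Types (x y : L2T) (a b l : R[i]).

Local Notation one := (zpow R 0).

(** The multiplier [z]. *)
Definition zmul : Linf (@theta R) := MkLinf (ess_bounded_zcirc R).

Lemma zcirc_conj (t : R) : zcirc t * (zcirc t)^*%C = 1.
Proof. by rewrite mulc_conj normc_zcirc expr1n. Qed.

Lemma zbar_zmul x : mulL2 (zbar R) (mulL2 zmul x) = x.
Proof.
pose c1 := MkLinf (ess_bounded_cst (@theta R) 1).
rewrite (@mulL2_comp _ _ _ _ _ _ c1) => [|t]; first exact: mulL2_id.
by rewrite mulrC /= zcirc_conj.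
Qed.

Lemma zmul_zbar x : mulL2 zmul (mulL2 (zbar R) x) = x.
Proof.
pose c1 := MkLinf (ess_bounded_cst (@theta R) 1).
rewrite (@mulL2_comp _ _ _ _ _ _ c1) => [|t]; first exact: mulL2_id.
by rewrite /= zcirc_conj.
Qed.

Lemma rnorm_zbar x : rnorm (mulL2 (zbar R) x) <= rnorm x.
Proof.
by rewrite -[leRHS]mul1r; apply: rnorm_mulL2 => t; rewrite normc_conj normc_zcirc.
Qed.

Lemma rnorm_zmul_le x : rnorm (mulL2 zmul x) <= rnorm x.
Proof.
by rewrite -[leRHS]mul1r; apply: rnorm_mulL2 => t; rewrite normc_zcirc.
Qed.

Lemma dotL2_zmul x y : dotL2 (mulL2 zmul x) (mulL2 zmul y) = dotL2 x y.
Proof. by rewrite (@dotL2_mul _ _ _ _ _ (zbar R)) ?zbar_zmul. Qed.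

Lemma zpowS n : zpow R n.+1 = mulL2 zmul (zpow R n).
Proof. by apply/esym; apply: mulL2E => t; rewrite /= exprS. Qed.

Lemma zmul_H2 x : x \in H2p -> mulL2 zmul x \in H2p.
Proof.
apply: H2pred_map => [a u v|u|n]; first by rewrite mulL2D mulL2Z.
  exact: rnorm_zmul_le.
by rewrite -zpowS zpow_H2.
Qed.

Lemma dotL2_one : dotL2 one one = 1.
Proof.
rewrite /zpow dotL2E /L2dot /=.
have -> : (fun t : R => complex.Re (1 * 1^*%C)) = cst (1 : R).
  by apply/funext => t /=; rewrite oppr0 mulr0 subr0 mulr1.
have -> : (fun t : R => complex.Im (1 * 1^*%C)) = cst (0 : R).
  by apply/funext => t /=; rewrite oppr0 mulr0 mul0r addr0.
rewrite !Rintegral_cst// mul0r mul1r.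
by have P1 := theta_setT R; rewrite /theta /= in P1 *; rewrite P1.
Qed.

Lemma rnorm_one : rnorm one = 1.
Proof.
have := dotL2_norm one; rewrite dotL2_one => -[] /esym/eqP.
by rewrite sqrf_eq1 => /orP[/eqP//|/eqP h]; have := rnorm_ge0 one; rewrite h; lra.
Qed.

Lemma dotL2_zpowS_one n : dotL2 (zpow R n.+1) one = 0.
Proof.
rewrite /zpow dotL2E /L2dot /=.
have [rE iE] := theta_integral_zcircX R n.
congr (_ +i* _); [rewrite -[RHS]rE|rewrite -[RHS]iE];
  by apply: eq_Rintegral => t _; rewrite -conjcE conjc1 mulr1.
Qed.

Lemma dotL2_one_le x : normc (dotL2 x one) <= rnorm x.
Proof. by have := cauchy_schwarz x one; rewrite rnorm_one mulr1. Qed.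

(** By density, it suffices that the powers [z^n], [n > 0], are orthogonal to
    the constants. *)
Lemma dotL2_zmul_one x : x \in H2p -> dotL2 (mulL2 zmul x) one = 0.
Proof.
move: x; apply: H2pred_ind.
- by rewrite mulL20 dotL20l.
- by move=> a x y x0 y0; rewrite mulL2D mulL2Z dotL2Dl dotL2Zl x0 y0 mulr0 addr0.
- by move=> n; rewrite -zpowS dotL2_zpowS_one.
move=> x Hx; apply: contrapT => /eqP/normc_gt0/Hx[y y0].
rewrite -[X in _ < normc X]subr0 -y0 -dotL2Bl -mulL2B ltNge.
by rewrite (le_trans (dotL2_one_le _))// rnorm_zmul_le.
Qed.

(** The backward shift [x |-> (x - <x, 1>) / z], defined on all of [L2]; only its
    restriction to the Hardy space is the adjoint of multiplication by [z]. *)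
Definition bshift x : L2T := mulL2 (zbar R) (x - dotL2 x one *: one).

Lemma bshift_lin a x y : bshift (a *: x + y) = a *: bshift x + bshift y.
Proof.
rewrite /bshift -mulL2Z -mulL2D; congr (mulL2 _ _).
by rewrite dotL2Dl dotL2Zl scalerDl opprD addrACA scalerBr scalerA.
Qed.

Lemma bshiftB x y : bshift (x - y) = bshift x - bshift y.
Proof. by rewrite addrC -scaleN1r bshift_lin scaleN1r addrC. Qed.

Lemma rnorm_bshift x : rnorm (bshift x) <= rnorm x.
Proof.
apply: le_trans (rnorm_zbar _) _; set c := dotL2 x one.
have := rnormD_sqr (x - c *: one) (c *: one).
rewrite subrK dotL2Zr dotL2Bl dotL2Zl dotL2_one -/c mulr1 subrr mulr0 mul0rn addr0.
move=> E; rewrite -[_ <= _]ler_sqr ?nnegrE ?rnorm_ge0// E.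
by rewrite lerDl sqr_ge0.
Qed.

Lemma bshift_one : bshift one = 0.
Proof.
by rewrite /bshift dotL2_one scale1r subrr mulL20.
Qed.

Lemma bshift_zmul x : x \in H2p -> bshift (mulL2 zmul x) = x.
Proof.
by move=> Hx; rewrite /bshift dotL2_zmul_one// scale0r subr0 zbar_zmul.
Qed.

Lemma zmul_bshift x : mulL2 zmul (bshift x) = x - dotL2 x one *: one.
Proof. exact: zmul_zbar. Qed.

Lemma bshift_H2 x : x \in H2p -> bshift x \in H2p.
Proof.
apply: H2pred_map; [exact: bshift_lin|exact: rnorm_bshift|case=> [|n]].
  by rewrite bshift_one rpred0.
by rewrite zpowS bshift_zmul zpow_H2.
Qed.

(** The function [1 / z] is orthogonal to the Hardy space: its multiples are the
    part of [h / z] that the projection removes. *)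
Lemma dotL2_zbar_one x : x \in H2p -> dotL2 (mulL2 (zbar R) one) x = 0.
Proof.
move=> Hx; rewrite (@dotL2_mul _ _ _ _ _ zmul) => [|t]; last by rewrite /= opprK.
by rewrite dotL2_conj dotL2_zmul_one// conjc0.
Qed.

Lemma normc_one_minus_ge a t : `|1 - normc a| <= normc (1 - a * zcirc t).
Proof.
rewrite ler_norml; apply/andP; split.
  have := normc_subr_ge (a * zcirc t) 1.
  rewrite -[normc (_ - 1)]normcN opprB Normc.normcM normc_zcirc Normc.normc1; lra.
have := normc_subr_ge 1 (a * zcirc t).
by rewrite Normc.normcM normc_zcirc Normc.normc1; lra.
Qed.

Fact ess_bounded_inv_one_minus a : normc a != 1 ->
  ess_bounded (@theta R) (fun t => (1 - a * zcirc t)^-1).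
Proof.
move=> a1; have n0 t : normc (1 - a * zcirc t) ^+ 2 != 0.
  rewrite expf_neq0// gt_eqF// (lt_le_trans _ (normc_one_minus_ge a t))//.
  by rewrite normr_gt0 subr_eq0 eq_sym.
split; last first.
  exists (`|1 - normc a|^-1); apply: aeW => t; rewrite normcV lef_pV2 ?posrE.
  - exact: normc_one_minus_ge.
  - rewrite (lt_le_trans _ (normc_one_minus_ge a t))//.
    by rewrite normr_gt0 subr_eq0 eq_sym.
  - by rewrite normr_gt0 subr_eq0 eq_sym.
case: a n0 {a1} => p q n0.
pose u (t : R) := 1 - (p * cos t - q * sin t).
pose v (t : R) := 0 - (p * sin t + q * cos t).
have uvE t : 1 - (p +i* q) * zcirc t = u t +i* v t by [].
have cc := @continuous_cos R; have cs := @continuous_sin R.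
have cu : continuous u.
  move=> t; apply: cvgB; [exact: cvg_cst|].
  by apply: cvgB; (apply: cvgM; first exact: cvg_cst); [exact: cc|exact: cs].
have cv : continuous v.
  move=> t; apply: cvgB; [exact: cvg_cst|].
  by apply: cvgD; (apply: cvgM; first exact: cvg_cst); [exact: cs|exact: cc].
have uv0 t : u t ^+ 2 + v t ^+ 2 != 0 by have := n0 t; rewrite uvE normcE2.
have cuv : continuous (fun t => (u t * u t + v t * v t)^-1).
  move=> t; apply: cvgV; first exact: uv0.
  by apply: cvgD; apply: cvgM; first [exact: cu|exact: cv].
split.
  have -> : (fun t => complex.Re (1 - (p +i* q) * zcirc t)^-1) =
      (fun t => u t * (u t * u t + v t * v t)^-1).
    by apply/funext => t; rewrite uvE.
  by apply: continuous_measurable_fun => t; apply: cvgM; [exact: cu|exact: cuv].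
have -> : (fun t => complex.Im (1 - (p +i* q) * zcirc t)^-1) =
    (fun t => - (v t * (u t * u t + v t * v t)^-1)).
  by apply/funext => t; rewrite uvE.
apply: continuous_measurable_fun => t; apply: cvgN.
by apply: cvgM; [exact: cv|exact: cuv].
Qed.

(** The multiplier [1 / (1 - a z)], for [a] off the unit circle. *)
Definition inv_one_minus a (ha : normc a != 1) : Linf (@theta R) :=
  MkLinf (ess_bounded_inv_one_minus ha).

Lemma one_minus_neq0 a t : normc a != 1 -> 1 - a * zcirc t != 0.
Proof.
move=> a1; apply: contraNneq a1 => /subr0_eq E.
have := congr1 (@normc R) E; rewrite Normc.normc1 Normc.normcM normc_zcirc mulr1.
by move=> <-.
Qed.

Lemma inv_one_minusE a (ha : normc a != 1) x :
  mulL2 (inv_one_minus ha) x = x + a *: mulL2 zmul (mulL2 (inv_one_minus ha) x).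
Proof.
set y := mulL2 _ x; have : mulL2 (one_plus_z (- a)) y = x.
  pose c1 := MkLinf (ess_bounded_cst (@theta R) 1).
  rewrite (@mulL2_comp _ _ _ _ _ _ c1) => [|t]; first exact: mulL2_id.
  by rewrite /= mulNr divff// one_minus_neq0.
rewrite (@mulL2_affine _ _ _ _ _ zmul 1 (- a))// scale1r scaleNr => <-.
by rewrite subrK.
Qed.

Lemma inv_one_minus_H2 a (ha : normc a != 1) x : normc a < 1 ->
  x \in H2p -> mulL2 (inv_one_minus ha) x \in H2p.
Proof.
move=> a1 Hx; apply: (H2pred_fixpoint (F := mulL2 zmul) _ _ _ a1 Hx).
- exact: mulL2B.
- exact: rnorm_zmul_le.
- exact: zmul_H2.
- exact: inv_one_minusE.
Qed.

(** The function [1 / (1 - a z)], for [a] in the unit disk: an eigenvector of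
    the backward shift, and the reproducing kernel at the conjugate of [a]. *)
Definition szego a (ha : normc a != 1) : L2T := mulL2 (inv_one_minus ha) one.

Section Kernel.
Variables (a : R[i]) (ha : normc a != 1) (a1 : normc a < 1).

Lemma szego_H2 : szego ha \in H2p.
Proof. exact: inv_one_minus_H2 (zpow_H2 R 0). Qed.

Lemma szegoE : szego ha = one + a *: mulL2 zmul (szego ha).
Proof. exact: inv_one_minusE. Qed.

(** The scalar product is [1 / (1 - a conj b)]: it solves the linear equation
    obtained from [k_a = 1 + a z k_a], since multiplication by [z] is isometric. *)
Lemma dotL2_szego_one : dotL2 (szego ha) one = 1.
Proof.
by rewrite szegoE dotL2Dl dotL2Zl dotL2_zmul_one ?szego_H2// mulr0 addr0 dotL2_one.
Qed.

Lemma bshift_szego : bshift (szego ha) = a *: szego ha.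
Proof.
rewrite /bshift dotL2_szego_one scale1r {1}szegoE addrC addKr.
by rewrite mulL2Z zbar_zmul.
Qed.

End Kernel.

Lemma dotL2_szego a (ha : normc a != 1) b (hb : normc b != 1) :
  normc a < 1 -> normc b < 1 ->
  dotL2 (szego ha) (szego hb) * (1 - a * b^*%C) = 1.
Proof.
move=> a1 b1.
have E : dotL2 (szego ha) (szego hb) = 1 + a * b^*%C * dotL2 (szego ha) (szego hb).
  rewrite {1}(szegoE hb) dotL2Dr dotL2Zr dotL2_szego_one//; congr (_ + _).
  rewrite {1}(szegoE ha) dotL2Dl dotL2Zl dotL2_zmul dotL2_conj.
  by rewrite dotL2_zmul_one ?szego_H2// conjc0 add0r mulrCA mulrA.
by rewrite mulrBr mulr1 {1}E [_ * (a * _)]mulrC addrK.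
Qed.

Lemma rnorm_szego a (ha : normc a != 1) : normc a < 1 ->
  rnorm (szego ha) ^+ 2 = (1 - normc a ^+ 2)^-1.
Proof.
move=> a1; have E : rnorm (szego ha) ^+ 2 * (1 - normc a ^+ 2) = 1.
  apply: complexI; rewrite rcM -dotL2_norm.
  by have := dotL2_szego ha ha a1 a1; rewrite mulc_conj -rmorphB.
have h : 1 - normc a ^+ 2 != 0.
  by apply/eqP => h; move: E; rewrite h mulr0 => /eqP; rewrite eq_sym oner_eq0.
by apply: (mulIf h); rewrite E mulVf.
Qed.

(** The resolvent of the backward shift at [l], [1 < |l|]: the equation
    [l g - (g - g(0)) / z = h] reads [(1 - l z) g = g(0) - z h], and has a
    solution without a pole at [1 / l] exactly when [g(0) = h(1 / l) / l]. *)
Section Resolvent.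
Variables (l : R[i]) (hl : normc l != 1) (hw : normc (l^-1)^*%C != 1).
Hypothesis l1 : 1 < normc l.

Definition bshift_res h : L2T :=
  mulL2 (inv_one_minus hl) ((l^-1 * dotL2 h (szego hw)) *: one - mulL2 zmul h).

Let w1 : normc (l^-1)^*%C < 1.
Proof. by rewrite normc_conj normcV invf_lt1// (lt_trans ltr01). Qed.

Let l0 : l != 0.
Proof. by apply: contraTneq l1 => ->; rewrite Normc.normc0 ltr10. Qed.

Let bshift_res_eq h : bshift_res h =
  ((l^-1 * dotL2 h (szego hw)) *: one - mulL2 zmul h)
    + l *: mulL2 zmul (bshift_res h).
Proof. exact: inv_one_minusE. Qed.

Lemma dotL2_bshift_res h :
  dotL2 (bshift_res h) one = l^-1 * dotL2 h (szego hw).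
Proof.
have := bshift_res_eq h; set g := bshift_res h; set c := l^-1 * _ => gE.
have oneE : one = szego hw - (l^-1)^*%C *: mulL2 zmul (szego hw).
  by rewrite {1}(szegoE hw) addrK.
(* pair the equation of g with z times the kernel *)
have := congr1 (fun v => dotL2 v (mulL2 zmul (szego hw))) gE.
rewrite dotL2Dl dotL2Bl !dotL2Zl !dotL2_zmul (dotL2_conj _ one).
rewrite dotL2_zmul_one ?szego_H2// conjc0 mulr0 sub0r => E.
rewrite oneE dotL2Br dotL2Zr conjcK {}E /c.
by move: (dotL2 g _) (dotL2 h _) => p q; field.
Qed.

Lemma bshift_resE h : l *: bshift_res h - bshift (bshift_res h) = h.
Proof.
rewrite /bshift dotL2_bshift_res; have := bshift_res_eq h.
set g := bshift_res h; set c := l^-1 * _ => gE.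
have -> : g - c *: one = mulL2 zmul (l *: g - h).
  by rewrite {1}gE addrC !addrA addNr add0r mulL2B mulL2Z addrC.
by rewrite zbar_zmul subKr.
Qed.

Lemma bshift_res_H2 h : h \in H2p -> bshift_res h \in H2p.
Proof.
move=> Hh; apply: (H2pred_fixpoint (F := bshift) (a := l^-1) (y := l^-1 *: h)).
- exact: bshiftB.
- exact: rnorm_bshift.
- exact: bshift_H2.
- by rewrite -normc_conj.
- exact: rpredZ.
have := bshift_resE h => E; rewrite -{2}E scalerBr scalerA mulVf// scale1r.
by rewrite subrK.
Qed.

End Resolvent.

End Shifts.

(** * Bounded operators and Toeplitz operators *)

Section OperatorFacts.
Context (R : realType) (V : normedModType R[i]).
Implicit Types (A B : V -> V) (x y h : V).

Lemma linear_opB A x y : linear A -> A (x - y) = A x - A y.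
Proof. by move=> lA; rewrite addrC -scaleN1r lA scaleN1r addrC. Qed.

Lemma linear_op0 A : linear A -> A 0 = 0.
Proof. by move=> lA; have := linear_opB 0 0 lA; rewrite !subrr. Qed.

Lemma linear_opZ A a x : linear A -> A (a *: x) = a *: A x.
Proof. by move=> lA; have := lA a x 0; rewrite (linear_op0 lA) !addr0. Qed.

(** A bounded right inverse of an injective linear operator is its inverse;
    linearity of the right inverse is automatic. *)
Lemma is_inverse_right A B (M : R) : linear A ->
    (forall x, A x = 0 -> x = 0) -> cancel B A ->
    (forall x, rnorm (B x) <= M * rnorm x) -> is_inverse A B.
Proof.
move=> lA A0 BK BM.
have Ainj x y : A x = A y -> x = y.
  by move=> xy; apply/subr0_eq/A0; rewrite linear_opB// xy subrr.
split; [split|by move=> x; apply: Ainj; rewrite BK|exact: BK].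
  by move=> a x y; apply: Ainj; rewrite lA !BK.
by exists M => x; rewrite !rnormE -rcM lecR.
Qed.

Lemma op_invE A B : is_inverse A B -> op_inv A = B.
Proof.
move=> AB; apply: xget_unique => // B' [_ AK' _]; case: AB => _ _ BK.
by apply/funext => x; rewrite -[in LHS](BK x) AK'.
Qed.

Lemma opnorm_le A (M : R) : 0 <= M ->
  (forall x, rnorm (A x) <= M * rnorm x) -> (opnorm A <= M%:E)%E.
Proof.
move=> M0 AM; apply: ge_ereal_sup => _ [x /= x1 <-]; rewrite lee_fin.
apply: le_trans (AM x) _; rewrite -[leRHS]mulr1 ler_wpM2l//.
by move: x1; rewrite rnormE -[X in _ <= X]/(1%:C) lecR.
Qed.

Lemma opnorm_ge A (M : R) x : (forall a, A (a *: x) = a *: A x) -> 0 < rnorm x ->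
  M * rnorm x <= rnorm (A x) -> (M%:E <= opnorm A)%E.
Proof.
move=> AZ x0 Mx; apply: le_trans (ereal_sup_ubound _); last first.
  exists (((rnorm x)^-1)%:C *: x) => //=.
  rewrite rnormE rnormZ normcR ger0_norm ?invr_ge0 ?rnorm_ge0//.
  by rewrite mulVf ?gt_eqF.
rewrite lee_fin AZ -/(rnorm _) rnormZ normcR ger0_norm ?invr_ge0 ?rnorm_ge0//.
by rewrite mulrC ler_pdivlMr.
Qed.

Lemma le_opnorm A (M : R) x : (forall a, A (a *: x) = a *: A x) ->
  (opnorm A <= M%:E)%E -> rnorm (A x) <= M * rnorm x.
Proof.
move=> AZ AM; have [->|x0] := eqVneq x 0.
  by have := AZ 0; rewrite !scale0r => ->; rewrite rnorm0 mulr0.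
have {}x0 := rnorm_gt0 x0; rewrite -ler_pdivrMr// -lee_fin.
apply: le_trans AM; apply: (opnorm_ge AZ x0).
by rewrite divfK// gt_eqF.
Qed.

End OperatorFacts.

Section ToeplitzOperators.
Variable R : realType.
Implicit Types (h k : H2 R) (a b : R[i]).

Lemma H2_ext h k : H2val h = H2val k -> h = k.
Proof. exact: val_inj. Qed.

Lemma projH2_unique g h :
  (forall k, dotL2 (g - H2val h) (H2val k) = 0) -> projH2 g = h.
Proof.
move=> gh; apply: xget_unique => // h' /= gh'; apply: H2_ext.
have : dotL2 (H2val h' - H2val h) (H2val (h' - h)) = 0.
  have -> : H2val h' - H2val h = (g - H2val h) - (g - H2val h').
    by rewrite opprB [RHS]addrC addrA subrK.
  by rewrite dotL2Bl gh gh' subrr.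
rewrite dotL2_norm => /complexI/eqP; rewrite sqrf_eq0 => /eqP/rnorm_eq0.
exact: subr0_eq.
Qed.

Lemma projH2_id h : projH2 (H2val h) = h.
Proof. by apply: projH2_unique => k; rewrite subrr dotL20l. Qed.

(** Multiplication by [z] on the Hardy space, its adjoint the backward shift,
    and the value at the origin of the disk, that is, the constant term. *)
Definition fshiftH h : H2 R := MkH2 (zmul_H2 (H2P h)).
Definition bshiftH h : H2 R := MkH2 (bshift_H2 (H2P h)).
Definition value0 h : R[i] := dotL2 (H2val h) (zpow R 0).

(** No projection is needed: multiplication by [1 + b z] preserves the Hardy
    space. *)
Lemma toeplitz_one_plus_z b h : toeplitz (one_plus_z b) h = h + b *: fshiftH h.
Proof.
rewrite /toeplitz (_ : mulL2 _ _ = H2val (h + b *: fshiftH h)); first exact: projH2_id.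
by rewrite (@mulL2_affine _ _ _ _ _ (zmul R) 1 b)// scale1r.
Qed.

Lemma toeplitz_zbar h : toeplitz (zbar R) h = bshiftH h.
Proof.
apply: projH2_unique => k; rewrite /= /bshift mulL2B subKr mulL2Z dotL2Zl.
by rewrite dotL2_zbar_one ?mulr0// H2P.
Qed.

Lemma bshiftH_linear : linear bshiftH.
Proof. by move=> a h k; apply: H2_ext; exact: bshift_lin. Qed.

Lemma rnorm_bshiftH h : rnorm (bshiftH h) <= rnorm h.
Proof. exact: rnorm_bshift. Qed.

Lemma bshiftH_fshiftH h : bshiftH (fshiftH h) = h.
Proof. by apply: H2_ext; apply: bshift_zmul; exact: H2P. Qed.

Lemma value0_linear a h k : value0 (a *: h + k) = a * value0 h + value0 k.
Proof. by rewrite /value0 /= dotL2Dl dotL2Zl. Qed.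

Lemma value0Z a h : value0 (a *: h) = a * value0 h.
Proof. exact: dotL2Zl. Qed.

Lemma normc_value0 h : normc (value0 h) <= rnorm h.
Proof. exact: dotL2_one_le. Qed.

(** The constant function [1], and the Szego kernel, as elements of the Hardy
    space. *)
Definition oneH : H2 R := MkH2 (zpow_H2 R 0).

Definition szegoH a (ha : normc a != 1) (a1 : normc a < 1) : H2 R :=
  MkH2 (szego_H2 ha a1).

Lemma bshiftH_szego a (ha : normc a != 1) (a1 : normc a < 1) :
  bshiftH (@szegoH a ha a1) = a *: szegoH ha a1.
Proof. by apply: H2_ext; exact: bshift_szego. Qed.

Lemma value0_szego a (ha : normc a != 1) (a1 : normc a < 1) :
  value0 (@szegoH a ha a1) = 1.
Proof. exact: dotL2_szego_one. Qed.

Lemma rnorm_szegoH a (ha : normc a != 1) (a1 : normc a < 1) :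
  rnorm (@szegoH a ha a1) = (Num.sqrt (1 - normc a ^+ 2))^-1.
Proof.
rewrite -[LHS]ger0_norm ?rnorm_ge0// -sqrtr_sqr [X in Num.sqrt X]rnorm_szego//.
by rewrite sqrtrV// subr_ge0 exprn_ile1 ?normc_ge0// ltW.
Qed.

Lemma fshiftH_bshiftH h : fshiftH (bshiftH h) = h - value0 h *: oneH.
Proof. by apply: H2_ext; exact: zmul_bshift. Qed.

Lemma szegoH_eq a (ha : normc a != 1) (a1 : normc a < 1) :
  szegoH ha a1 - a *: fshiftH (@szegoH a ha a1) = oneH.
Proof. by apply: H2_ext; rewrite /= {1}szegoE addrK. Qed.

Lemma fshiftH_linear : linear fshiftH.
Proof. by move=> a h k; apply: H2_ext; rewrite /= mulL2D mulL2Z. Qed.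

Lemma toeplitz_one_plus_z_invertible b : normc b < 1 ->
  exists B, is_inverse (toeplitz (one_plus_z b)) B.
Proof.
move=> b1; have nb1 : normc (- b) < 1 by rewrite normcN.
have hb : normc (- b) != 1 by rewrite lt_eqF.
pose B h : H2 R := MkH2 (inv_one_minus_H2 hb nb1 (H2P h)).
have b0 : 0 <= 1 - normc b by rewrite subr_ge0 ltW.
exists B; apply: (@is_inverse_right _ _ _ _ (1 - normc b)^-1).
- move=> a h k; rewrite !toeplitz_one_plus_z fshiftH_linear.
  rewrite !scalerDr !scalerA addrACA; congr (_ + _ + _).
  by rewrite mulrC.
- move=> h; rewrite toeplitz_one_plus_z => /eqP; rewrite addr_eq0 => /eqP hE.
  (* |h| = |b| |z h| <= |b| |h| *)
  have : rnorm h <= normc b * rnorm h.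
    rewrite {1}hE rnormN rnormZ ler_wpM2l ?normc_ge0//.
    exact: rnorm_zmul_le.
  have := rnorm_ge0 h => h0 hh; apply: rnorm_eq0; nra.
- move=> h; rewrite toeplitz_one_plus_z; apply: H2_ext => /=.
  by rewrite {1}inv_one_minusE scaleNr subrK.
- move=> h; apply: rnorm_mulL2 => t; rewrite normcV lef_pV2 ?posrE.
  + have := normc_one_minus_ge (- b) t; rewrite normcN ger0_norm//.
  + have := normc_one_minus_ge (- b) t; rewrite normcN ger0_norm// => /(lt_le_trans _).
    by apply; rewrite subr_gt0.
  + by rewrite subr_gt0.
Qed.

End ToeplitzOperators.

(** * The constant of the resolvent estimate *)

Section Constant.
Variable R : realType.

(** The constant of the bounds on the resolvent. *)
Definition resolvent_const : R :=
  Num.sqrt 2 * (Num.sqrt 5 - 1) / (1 + Num.sqrt 5) `^ (3 / 2).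

(** The golden ratio. *)
Definition golden : R := (1 + Num.sqrt 5) / 2.

Let s2 : Num.sqrt 5 ^+ 2 = 5 :> R.
Proof. by rewrite sqr_sqrtr. Qed.

Let s3 : Num.sqrt 5 ^+ 3 = 5 * Num.sqrt 5 :> R.
Proof. by rewrite exprS s2 mulrC. Qed.

Let s4 : Num.sqrt 5 ^+ 4 = 25 :> R.
Proof. by rewrite (exprM _ 2 2) s2 -natrX. Qed.

Let s_bounds : 2 < (Num.sqrt 5 : R) < 3.
Proof.
have s0 : 0 <= (Num.sqrt 5 : R) by exact: sqrtr_ge0.
by apply/andP; split; rewrite ltNge; apply/negP => h; have := s2; nra.
Qed.

Lemma golden_gt1 : 1 < golden.
Proof. by rewrite /golden; have /andP[] := s_bounds; lra. Qed.

Lemma resolvent_const_ge0 : 0 <= resolvent_const.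
Proof.
have /andP[s_gt _] := s_bounds.
by rewrite /resolvent_const divr_ge0 ?powR_ge0// mulr_ge0 ?sqrtr_ge0//; lra.
Qed.

Lemma resolvent_const_sqr : resolvent_const ^+ 2 = (5 * Num.sqrt 5 - 11) / 2.
Proof.
have /andP[s_gt _] := s_bounds.
rewrite /resolvent_const exprMn exprVn exprMn sqr_sqrtr//.
rewrite -[(_ `^ _) ^+ 2]powR_mulrn ?powR_ge0// -powRrM.
rewrite (_ : 3 / 2 * 2%:R = 3%:R :> R); last by rewrite divfK.
rewrite powR_mulrn; last by lra.
have h : (1 + Num.sqrt 5) ^+ 3 != 0 :> R by rewrite expf_neq0//; lra.
apply: (mulIf h); rewrite divfK//.
by move: s2 s3 s4; set s := Num.sqrt 5 => ss sss ssss; lra.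
Qed.

Lemma rate_sqr (r : R) : 1 < r ->
  ((r - 1) / (r * Num.sqrt (r ^+ 2 - 1))) ^+ 2 = (r - 1) / (r ^+ 2 * (r + 1)).
Proof.
move=> r1; have r2 : 0 <= r ^+ 2 - 1 by nra.
rewrite exprMn exprVn exprMn sqr_sqrtr//.
have -> : r ^+ 2 - 1 = (r - 1) * (r + 1) by ring.
by field; do ?[apply/andP; split]; lra.
Qed.

(** The rate [(r - 1) / (r sqrt (r^2 - 1))] is largest at the golden ratio. *)
Lemma rate_le (r : R) : 1 < r -> (r - 1) / (r * Num.sqrt (r ^+ 2 - 1)) <= resolvent_const.
Proof.
move=> r1; have /andP[s_gt _] := s_bounds.
have q0 : 0 <= (r - 1) / (r * Num.sqrt (r ^+ 2 - 1)).
  by rewrite divr_ge0 ?mulr_ge0 ?sqrtr_ge0//; lra.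
rewrite -[_ <= _]ler_sqr ?nnegrE ?resolvent_const_ge0// rate_sqr// resolvent_const_sqr.
rewrite ler_pdivrMr; last by rewrite mulr_gt0 ?exprn_gt0//; lra.
(* the golden ratio is a double root of the difference *)
rewrite -subr_ge0 (_ : _ - _ = (5 * Num.sqrt 5 - 11) / 2 * (r - golden) ^+ 2
  * (r + 2 + Num.sqrt 5)); last first.
  by rewrite /golden; move: s2 s3 s4; set s := Num.sqrt 5 => ss sss ssss; nra.
have q1 : 0 <= 5 * Num.sqrt 5 - 11 :> R by have := s2; nra.
apply: mulr_ge0; last by lra.
by apply: mulr_ge0; [lra|exact: sqr_ge0].
Qed.

Lemma rate_golden :
  (golden - 1) / (golden * Num.sqrt (golden ^+ 2 - 1)) = resolvent_const.
Proof.
have g1 := golden_gt1; have /andP[s_gt _] := s_bounds.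
have q0 : 0 <= (golden - 1) / (golden * Num.sqrt (golden ^+ 2 - 1)).
  by rewrite divr_ge0 ?mulr_ge0 ?sqrtr_ge0//; lra.
rewrite -[LHS]ger0_norm// -[RHS]ger0_norm ?resolvent_const_ge0// -!sqrtr_sqr.
congr Num.sqrt.
rewrite rate_sqr// resolvent_const_sqr.
have h : golden ^+ 2 * (golden + 1) != 0 by rewrite mulf_neq0 ?expf_neq0//; lra.
apply: (mulIf h); rewrite divfK// /golden.
by move: s2 s3 s4; set s := Num.sqrt 5 => ss sss ssss; lra.
Qed.

End Constant.

(** * The perturbed backward shift *)

Section PerturbedShift.
Variables (R : realType) (b : R[i]).
Hypotheses (hb0 : 0 < normc b) (hb1 : normc b < 1).
Implicit Types (h k x : H2 R) (a l w : R[i]).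

Local Notation S := (@bshiftH R).
Local Notation ev := (@value0 R).
Local Notation e := (oneH R).

Let nb1 : normc (- b) < 1.
Proof. by rewrite normcN. Qed.

Let nb_neq1 : normc (- b) != 1.
Proof. by rewrite lt_eqF. Qed.

(** The function [1 / (1 + b z)]. *)
Definition invphi : H2 R := szegoH nb_neq1 nb1.
Local Notation u := invphi.

(** The conjugate of the backward shift by multiplication by [1 + b z], as a
    rank one perturbation of the backward shift. *)
Definition pshift h : H2 R := S h + (b * ev h) *: u.
Local Notation A := pshift.

Local Notation N := ((Num.sqrt (1 - normc b ^+ 2))^-1).

Let N_ge0 : 0 <= N :> R.
Proof. by rewrite invr_ge0 sqrtr_ge0. Qed.

Let rnorm_u : rnorm u = N.
Proof. by rewrite rnorm_szegoH normcN. Qed.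

Let Su : S u = - b *: u.
Proof. exact: bshiftH_szego. Qed.

Let evu : ev u = 1.
Proof. exact: value0_szego. Qed.

Let eve : ev e = 1.
Proof. exact: dotL2_one. Qed.

Let Se : S e = 0.
Proof. by apply: H2_ext; exact: bshift_one. Qed.

Let rnorm_e : rnorm e = 1.
Proof. exact: rnorm_one. Qed.

Let u_gt0 : 0 < rnorm u.
Proof. by rewrite rnorm_u invr_gt0 sqrtr_gt0 subr_gt0 exprn_ilt1// normc_ge0. Qed.

Lemma toeplitz_conjugate :
  op_inv (toeplitz (one_plus_z b)) \o toeplitz (zbar R) \o toeplitz (one_plus_z b)
  = A.
Proof.
have [B BI] := toeplitz_one_plus_z_invertible hb1; rewrite (op_invE BI).
case: BI => _ TK _; apply/funext => h; rewrite /= -[RHS]TK; congr (B _).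
rewrite toeplitz_zbar !toeplitz_one_plus_z addrC bshiftH_linear bshiftH_fshiftH.
have eE : e = u + b *: fshiftH u by rewrite -(szegoH_eq nb_neq1 nb1) scaleNr opprK.
rewrite /A (addrC (S h)) fshiftH_linear fshiftH_bshiftH eE.
set v := fshiftH u; set c := b * ev h.
have -> : b *: (c *: v + (h - ev h *: (u + b *: v))) = b *: h - c *: u.
  rewrite scalerDr scalerBr !scalerA -/c scalerDr scalerA opprD addrCA.
  by rewrite [b * c]mulrC [X in _ + X = _]addrC subrK.
by rewrite [c *: u + _]addrC addrACA [S h + _]addrC -addrA [c *: u - _]subrr addr0.
Qed.

Lemma pshift_linear : linear A.
Proof.
move=> a h k; rewrite /pshift bshiftH_linear value0_linear.
rewrite mulrDr scalerDl mulrCA addrACA; congr (_ + _).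
by rewrite scalerDr scalerA.
Qed.

Lemma pshift_u : A u = 0.
Proof. by rewrite /pshift Su evu mulr1 scaleNr addNr. Qed.

Lemma pshift_one : A e = b *: u.
Proof. by rewrite /pshift Se eve mulr1 add0r. Qed.

Lemma rnorm_pshift h : rnorm (A h) <= (1 + normc b * N) * rnorm h.
Proof.
apply: le_trans (rnormD _ _) _; rewrite rnormZ rnorm_u Normc.normcM mulrDl mul1r.
rewrite lerD ?rnorm_bshiftH// mulrAC ler_wpM2l ?normc_value0//.
by rewrite mulr_ge0 ?normc_ge0.
Qed.

(** Because [A u = 0]; as [S] is a contraction, it follows that no positive power
    of [A] has a norm larger than that of [A]. *)
Lemma iter_pshift n h : iter n.+1 A h = A (iter n S h).
Proof.
elim: n => [//|n IH]; rewrite iterS IH {2}/pshift.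
by rewrite addrC pshift_linear pshift_u scaler0 add0r.
Qed.

Lemma rnorm_iter_bshiftH n h : rnorm (iter n S h) <= rnorm h.
Proof. by elim: n => //= n; apply: le_trans; exact: rnorm_bshiftH. Qed.

Lemma power_bound_le : (power_bound A <= (1 + normc b * N)%:E)%E.
Proof.
have M0 : 0 <= normc b * N by rewrite mulr_ge0 ?normc_ge0.
apply: ge_ereal_sup => _ [n _ <-]; apply: opnorm_le; first by lra.
case: n => [|n] h; first by rewrite ler_peMl ?rnorm_ge0//; lra.
rewrite iter_pshift; apply: le_trans (rnorm_pshift _) _.
by apply: ler_wpM2l; [lra|exact: rnorm_iter_bshiftH].
Qed.

Lemma opnorm_le_power_bound n : (opnorm (iter n A) <= power_bound A)%E.
Proof. by apply: ereal_sup_ubound; exists n. Qed.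

Lemma power_bound_ge1 : (1%:E <= power_bound A)%E.
Proof.
apply: le_trans (opnorm_le_power_bound 0); apply: (@opnorm_ge _ _ _ _ e) => //.
  by rewrite rnorm_e ltr01.
by rewrite mul1r.
Qed.

Lemma power_bound_ge : ((normc b * N)%:E <= power_bound A)%E.
Proof.
apply: le_trans (opnorm_le_power_bound 1); apply: (@opnorm_ge _ _ _ _ e).
- by move=> a; exact: linear_opZ pshift_linear.
- by rewrite rnorm_e ltr01.
- by rewrite /= pshift_one rnormZ rnorm_u rnorm_e mulr1.
Qed.

(** The resolvents of the backward shift and of its perturbation at a point
    outside of the closed unit disk. *)
Section Resolvent.
Variable l : R[i].
Hypothesis l1 : 1 < normc l.
Local Notation r := (normc l).

Let l0 : l != 0.
Proof. by apply: contraTneq l1 => ->; rewrite Normc.normc0 ltr10. Qed.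

Let hl : normc l != 1.
Proof. by rewrite gt_eqF. Qed.

Let w1 : normc (l^-1)^*%C < 1.
Proof. by rewrite normc_conj normcV invf_lt1// (lt_trans ltr01). Qed.

Let hw : normc (l^-1)^*%C != 1.
Proof. by rewrite lt_eqF. Qed.

(** The inverse of [l - S]. *)
Definition bshiftH_res h : H2 R := MkH2 (bshift_res_H2 hl hw l1 (H2P h)).
Local Notation G := bshiftH_res.

Lemma bshiftH_resE h : l *: G h - S (G h) = h.
Proof. by apply: H2_ext; exact: bshift_resE. Qed.

Lemma value0_bshiftH_res h : normc (ev (G h)) <= rnorm h / Num.sqrt (r ^+ 2 - 1).
Proof.
have -> : ev (G h) = l^-1 * dotL2 (H2val h) (szego hw).
  exact: dotL2_bshift_res.
rewrite Normc.normcM mulrC normcV ler_pdivrMr ?(lt_trans ltr01)//.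
apply: le_trans (cauchy_schwarz _ _) _.
rewrite -[rnorm (szego hw)]/(rnorm (szegoH hw w1)) rnorm_szegoH.
rewrite -mulrA ler_wpM2l ?rnorm_ge0// normc_conj normcV.
have r0 : 0 < r := lt_trans ltr01 l1.
have r2 : 0 < r ^+ 2 - 1 by rewrite subr_gt0 exprn_egt1.
have -> : 1 - r^-1 ^+ 2 = (r ^+ 2 - 1) / r ^+ 2.
  by rewrite exprVn mulrBl divff ?mul1r// expf_neq0 ?gt_eqF.
rewrite (sqrtrM _ (ltW r2)) sqrtrV ?sqr_ge0// sqrtr_sqr (ger0_norm (ltW r0)).
by rewrite invfM invrK.
Qed.

Lemma rnorm_bshiftH_res h : rnorm (G h) <= rnorm h / (r - 1).
Proof.
have := bshiftH_resE h; set g := G h => gE.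
have : rnorm (l *: g) <= rnorm h + rnorm g.
  rewrite -[l *: g](subrK (S g)) gE (le_trans (rnormD _ _))// lerD2l.
  exact: rnorm_bshiftH.
rewrite rnormZ => hg; rewrite ler_pdivlMr ?subr_gt0//; lra.
Qed.

Let bshift_inj x : l *: x - S x = 0 -> x = 0.
Proof.
move=> /subr0_eq xE; apply: rnorm_eq0.
have := rnorm_bshiftH x; rewrite -xE rnormZ => h.
have r1 : 0 < r - 1 by rewrite subr_gt0.
apply/eqP; rewrite eq_le rnorm_ge0 andbT -(pmulr_rle0 _ r1).
by rewrite mulrBl mul1r subr_le0.
Qed.

(** If [A x = l x] then [(l - S) x] is a multiple of [u], and so is [x], because
    [u] is an eigenvector of [S] and [l - S] is injective; evaluating at the
    origin then gives [x = 0]. *)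
Lemma pshift_resolvent_inj x : scalar_sub l A x = 0 -> x = 0.
Proof.
have lb0 : l + b != 0.
  rewrite addr_eq0; apply: contraTneq l1 => ->.
  by rewrite normcN -leNgt ltW.
rewrite /scalar_sub /pshift opprD addrA => /subr0_eq xE.
have {}xE : x = (b * ev x / (l + b)) *: u.
  apply/subr0_eq/bshift_inj.
  set c := b * ev x in xE *.
  have cu : l *: ((c / (l + b)) *: u) - S ((c / (l + b)) *: u) = c *: u.
    rewrite (linear_opZ _ _ (@bshiftH_linear R)) Su scaleNr scalerN opprK.
    by rewrite !scalerA -scalerDl mulrC -mulrDr divfK.
  rewrite (linear_opB _ _ (@bshiftH_linear R)) scalerBr opprB.
  by rewrite [_ - S x]addrC addrACA xE -cu addrACA subrr addNr addr0.
have : ev x = 0.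
  have E := congr1 ev xE; rewrite value0Z evu mulr1 in E.
  have : ev x * (l + b) = b * ev x by rewrite {1}E divfK.
  rewrite mulrDr [b * _]mulrC => /(canRL (addrK _)); rewrite subrr.
  by move=> /eqP; rewrite mulf_eq0 (negPf l0) orbF => /eqP.
by move=> x0; rewrite xE x0 mulr0 mul0r scale0r.
Qed.

(** The inverse of [l - A]. *)
Definition pshift_res h : H2 R := G h + (l^-1 * b * ev (G h)) *: u.

Lemma pshift_resE h : scalar_sub l A (pshift_res h) = h.
Proof.
rewrite /scalar_sub /pshift_res [G h + _]addrC pshift_linear pshift_u scaler0 add0r.
rewrite scalerDr scalerA !mulrA mulfV// mul1r /pshift opprD.
by rewrite [_ + l *: _]addrC addrACA subrr addr0 bshiftH_resE.
Qed.

(** The form of the resolvent that relates it to the powers of [A]. *)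
Lemma pshift_res_power h : pshift_res h = l^-1 *: (h + A (G h)).
Proof.
have hE : h + S (G h) = l *: G h by rewrite -{1}(bshiftH_resE h) subrK.
by rewrite /pshift addrA hE scalerDr !scalerA mulVf// scale1r mulrA.
Qed.

Lemma rnorm_pshift_res h :
  rnorm (pshift_res h) <=
    (1 + (r - 1) / (r * Num.sqrt (r ^+ 2 - 1)) * (normc b * N)) / (r - 1) * rnorm h.
Proof.
have r0 : 0 < r := lt_trans ltr01 l1.
have r1 : r - 1 != 0 by rewrite subr_eq0 gt_eqF.
apply: le_trans (rnormD _ _) _; rewrite rnormZ rnorm_u !Normc.normcM normcV.
set q := Num.sqrt (r ^+ 2 - 1).
have -> : (1 + (r - 1) / (r * q) * (normc b * N)) / (r - 1) * rnorm h =
    rnorm h / (r - 1) + r^-1 * normc b * (rnorm h / q) * N.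
  have q0 : q != 0 by rewrite gt_eqF// sqrtr_gt0 subr_gt0 exprn_egt1.
  have r0' : r != 0 by rewrite gt_eqF.
  by field; rewrite q0 r0' r1 -invr_eq0 -rnorm_u gt_eqF.
rewrite lerD ?rnorm_bshiftH_res// ler_wpM2r// ler_wpM2l//.
  by rewrite mulr_ge0 ?invr_ge0 ?normc_ge0.
exact: value0_bshiftH_res.
Qed.

Lemma scalar_sub_linear : linear (scalar_sub l A).
Proof.
move=> a h k; rewrite /scalar_sub pshift_linear opprD [l *: (_ + _)]scalerDr addrACA.
by rewrite scalerBr !scalerA [l * a]mulrC.
Qed.

Lemma pshift_res_inverse : is_inverse (scalar_sub l A) pshift_res.
Proof.
apply: is_inverse_right rnorm_pshift_res.
- exact: scalar_sub_linear.
- exact: pshift_resolvent_inj.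
- exact: pshift_resE.
Qed.

Lemma scalar_subK h : op_inv (scalar_sub l A) (scalar_sub l A h) = h.
Proof. by rewrite (op_invE pshift_res_inverse); case: pshift_res_inverse. Qed.

Lemma op_inv_scalar_subZ a h :
  op_inv (scalar_sub l A) (a *: h) = a *: op_inv (scalar_sub l A) h.
Proof.
by rewrite (op_invE pshift_res_inverse); case: pshift_res_inverse => -[+ _] _ _;
  exact: linear_opZ.
Qed.

End Resolvent.

Lemma spectrum_pshift_le1 m : spectrum A m -> normc m <= 1.
Proof.
move=> sm; rewrite leNgt; apply/negP => m1.
by apply: sm; exists (pshift_res m1); exact: pshift_res_inverse.
Qed.

(** The eigenvector is [m k + b u], with [k] the eigenvector of [S] for [m]; it
    vanishes when [m = - b]. *)
Lemma spectrum_pshift_disk m : normc m < 1 -> m != - b -> spectrum A m.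
Proof.
move=> m1 mb [B [_ BK _]].
have hm : normc m != 1 by rewrite lt_eqF.
pose k := szegoH hm m1; pose x := m *: k + b *: u.
have Ax : scalar_sub m A x = 0.
  rewrite /scalar_sub /x pshift_linear (linear_opZ _ _ pshift_linear) pshift_u.
  rewrite scaler0 addr0 /pshift bshiftH_szego value0_szego mulr1.
  by rewrite subrr.
have A0 : scalar_sub m A 0 = 0.
  by rewrite /scalar_sub scaler0 (linear_op0 pshift_linear) subrr.
have x0 : x = 0 by rewrite -(BK x) Ax -A0 BK.
have := congr1 ev x0; rewrite /x value0_linear value0Z value0_szego evu !mulr1.
rewrite -(scale0r e) value0Z mul0r => /eqP; rewrite addr_eq0.
by rewrite (negPf mb).
Qed.

Lemma dist_spectrum_pshift l : 1 < normc l ->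
  dist l (spectrum A) = (normc l - 1)%:E.
Proof.
move=> l1; have l0 : 0 < normc l := lt_trans ltr01 l1.
apply/eqP; rewrite eq_le; apply/andP; split; last first.
  apply/ereal_infP => _ [m /spectrum_pshift_le1 m1 <-].
  rewrite lee_fin; have := normc_subr_ge l m; lra.
suff H (eps : R) : 0 < eps -> (dist l (spectrum A) <= (normc l - 1 + eps)%:E)%E.
  by apply/lee_addgt0Pr => eps eps0; rewrite -EFinD; exact: H.
move=> eps0.
(* a point of the open disk on the ray through l, with modulus t > |b| *)
pose t := Num.max ((1 + normc b) / 2) (1 - eps).
have mid (q : R) : q < 1 -> q < (1 + q) / 2 /\ (1 + q) / 2 < 1.
  by move=> q1; split; lra.
have [h3 h1] := mid _ hb1; have h2 : 1 - eps < 1 by lra.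
have t1 : t < 1 by rewrite gt_max h1.
have tb : normc b < t by rewrite lt_max h3.
have te : 1 - eps <= t by rewrite le_max lexx orbT.
pose m := (t / normc l)%:C * l.
have t0 : 0 < t := lt_trans hb0 tb.
have nm : normc m = t.
  by rewrite Normc.normcM normcR ger0_norm ?divr_ge0 ?ltW// divfK ?gt_eqF.
have sm : spectrum A m.
  apply: spectrum_pshift_disk; first by rewrite nm.
  by apply: contraTneq tb => mE; rewrite -nm mE normcN ltxx.
apply: le_trans (ereal_inf_lbound _) _; first by exists m; [exact: sm|].
have -> : l - m = (1 - t / normc l)%:C * l.
  by rewrite rmorphB mulrBl mul1r.
have tl : t / normc l <= 1 by rewrite ler_pdivrMr// mul1r; lra.
rewrite Normc.normcM normcR ger0_norm ?subr_ge0//.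
rewrite mulrBl mul1r divfK ?gt_eqF// lee_fin; lra.
Qed.

Lemma resolvent_bound_le (M : R) :
  (forall l, 1 < normc l ->
    (opnorm (op_inv (scalar_sub l A)) <= (M / (normc l - 1))%:E)%E) ->
  (resolvent_bound A <= M%:E)%E.
Proof.
move=> HM; apply: ge_ereal_sup => _ [l /= l1 <-].
have r1 : 0 < normc l - 1 by rewrite subr_gt0.
rewrite dist_spectrum_pshift//.
apply: le_trans (_ : (normc l - 1)%:E * (M / (normc l - 1))%:E <= _)%E.
  by apply: lee_wpmul2l; [rewrite lee_fin ltW|exact: HM].
by rewrite -EFinM lee_fin mulrC divfK// gt_eqF.
Qed.

(** A vector [h] bounds the norm of the resolvent at [l] from below through the
    image of [h] by [l - A]. *)
Lemma resolvent_bound_ge l h (M : R) : 1 < normc l -> 0 < rnorm h ->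
  (0 < rnorm (scalar_sub l A h)) ->
  M * rnorm (scalar_sub l A h) <= rnorm h ->
  (((normc l - 1) * M)%:E <= resolvent_bound A)%E.
Proof.
move=> l1 h0 Ah0 hM; have r1 : 0 < normc l - 1 by rewrite subr_gt0.
apply: le_trans (ereal_sup_ubound _); last by exists l.
rewrite dist_spectrum_pshift// EFinM; apply: lee_wpmul2l.
  by rewrite lee_fin ltW.
apply: (@opnorm_ge _ _ _ _ (scalar_sub l A h)) => //.
  by move=> a; exact: op_inv_scalar_subZ.
by rewrite scalar_subK.
Qed.

Lemma resolvent_bound_ge1 : (1%:E <= resolvent_bound A)%E.
Proof.
suff H (eps : R) : 0 < eps -> (1%:E <= resolvent_bound A + eps%:E)%E.
  by apply/lee_addgt0Pr => eps eps0; exact: H.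
(* take h = u and l = 1 + 1/eps *)
move=> eps0; pose r := 1 + eps^-1; have e0 : 0 < eps^-1 by rewrite invr_gt0.
have r1 : 1 < r by rewrite /r; lra.
have nr : normc r%:C = r by rewrite normcR ger0_norm//; lra.
have Au : scalar_sub r%:C A u = r%:C *: u by rewrite /scalar_sub pshift_u subr0.
have nAu : rnorm (scalar_sub r%:C A u) = r * rnorm u by rewrite Au rnormZ nr.
have r0 : 0 < r by lra.
have rb : (((normc r%:C - 1) * r^-1)%:E <= resolvent_bound A)%E.
  apply: (@resolvent_bound_ge r%:C u) => //; first by rewrite nr.
    by rewrite nAu mulr_gt0.
  by rewrite nAu mulrA mulVf ?mul1r// gt_eqF.
apply: le_trans (leeD rb (lexx _)); rewrite -EFinD lee_fin nr.
rewrite -subr_ge0.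
have -> : (r - 1) * r^-1 + eps - 1 = eps - r^-1.
  by rewrite mulrBl mul1r mulfV ?gt_eqF//; ring.
have er : eps^-1 <= r by rewrite /r lerDr.
by rewrite subr_ge0 invf_ple ?posrE.
Qed.

Lemma resolvent_bound_le_const :
  (resolvent_bound A <= (1 + resolvent_const R * (normc b * N))%:E)%E.
Proof.
have bN : 0 <= normc b * N by rewrite mulr_ge0 ?normc_ge0.
have cb : 0 <= resolvent_const R * (normc b * N) by rewrite mulr_ge0 ?resolvent_const_ge0.
apply: resolvent_bound_le => l l1; have r1 : 0 < normc l - 1 by rewrite subr_gt0.
rewrite (op_invE (pshift_res_inverse l1)); apply: opnorm_le => [|h].
  by rewrite divr_ge0 ?ltW//; lra.
apply: le_trans (rnorm_pshift_res l1 h) _.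
rewrite ler_wpM2r ?rnorm_ge0// ler_wpM2r ?invr_ge0 ?(ltW r1)// lerD2l.
by rewrite ler_wpM2r// rate_le.
Qed.

Lemma resolvent_bound_le_power_bound : (resolvent_bound A <= power_bound A)%E.
Proof.
have pf : (power_bound A \is a fin_num)%E.
  rewrite fin_numE; apply/andP; split.
    by rewrite gt_eqF// (lt_le_trans _ power_bound_ge1)// ltNyr.
  by rewrite lt_eqF// (le_lt_trans power_bound_le)// ltry.
rewrite -(fineK pf); set M := fine _.
have M1 : 1 <= M by rewrite -lee_fin fineK// power_bound_ge1.
have AM h : rnorm (A h) <= M * rnorm h.
  apply: le_opnorm => [a|]; first exact: linear_opZ pshift_linear.
  by rewrite fineK// (opnorm_le_power_bound 1).
clear pf; clearbody M.
apply: resolvent_bound_le => l l1.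
have r1 : 0 < normc l - 1 by rewrite subr_gt0.
have r0 : 0 < normc l := lt_trans ltr01 l1.
rewrite (op_invE (pshift_res_inverse l1)); apply: opnorm_le => [|h].
  by rewrite divr_ge0 ?ltW//; lra.
rewrite pshift_res_power rnormZ normcV mulrC ler_pdivrMr//.
have hh : rnorm (h + A (bshiftH_res l1 h)) <=
    M * rnorm h + M * (rnorm h / (normc l - 1)).
  apply: le_trans (rnormD _ _) _; apply: lerD.
    by rewrite ler_peMl ?rnorm_ge0.
  apply: le_trans (AM _) _; rewrite ler_wpM2l ?rnorm_bshiftH_res//; lra.
apply: le_trans hh _; rewrite le_eqVlt; apply/orP; left; apply/eqP.
by field; rewrite gt_eqF.
Qed.

Lemma resolvent_bound_ge_const :
  ((resolvent_const R * (normc b * N))%:E <= resolvent_bound A)%E.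
Proof.
set g := golden R; have g1 : 1 < g := golden_gt1 R.
have g0 : 0 < g := lt_trans ltr01 g1.
have bb : normc b != 0 by rewrite gt_eqF.
(* l = g b / |b|, so that b / l = |b| / g is a positive real *)
pose l := (g / normc b)%:C * b.
have nl : normc l = g.
  by rewrite Normc.normcM normcR ger0_norm ?divr_ge0 ?normc_ge0 ?ltW// divfK.
have l1 : 1 < normc l by rewrite nl.
have l0 : l != 0 by apply: contraTneq l1 => ->; rewrite Normc.normc0 ltr10.
pose w := l^-1; pose t := normc b / g.
have wb : w * b = t%:C.
  apply: (mulfI l0); rewrite mulrA mulfV// mul1r /l /t mulrAC -rcM.
  by rewrite mulrA divfK// mulfV ?mul1r// gt_eqF.
have t0 : 0 < t by rewrite divr_gt0.
have nw : normc w = g^-1 by rewrite normcV nl.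
have w1 : normc w^*%C < 1 by rewrite normc_conj nw invf_lt1.
have hw : normc w^*%C != 1 by rewrite lt_eqF.
(* (l - A) x is a multiple of the kernel k *)
pose k := szegoH hw w1; pose x := k + t%:C *: u.
have Ax : scalar_sub l A x = (l - w^*%C) *: k.
  rewrite /scalar_sub /x [k + _]addrC pshift_linear pshift_u scaler0 add0r.
  rewrite /pshift bshiftH_szego value0_szego mulr1 scalerDr scalerA -wb mulrA.
  rewrite mulfV// mul1r opprD [_ + l *: k]addrC addrACA subrr addr0.
  by rewrite scalerBl.
have p0 : 0 < g ^+ 2 - 1 by rewrite subr_gt0 exprn_egt1.
have pE : 1 - g^-1 ^+ 2 = (g ^+ 2 - 1) / g ^+ 2.
  by rewrite exprVn mulrBl divff ?mul1r// expf_neq0 ?gt_eqF.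
have q0 : 0 < Num.sqrt (g ^+ 2 - 1) by rewrite sqrtr_gt0.
have nAx : rnorm (scalar_sub l A x) = Num.sqrt (g ^+ 2 - 1).
  have lw : l - w^*%C = (1 - g^-1 ^+ 2)%:C * l.
    have -> : (1 - g^-1 ^+ 2)%:C = 1 - w * w^*%C.
      by rewrite mulc_conj nw; exact: rmorphB.
    by rewrite mulrBl mul1r mulrAC mulVf// mul1r.
  rewrite Ax rnormZ rnorm_szegoH normc_conj nw lw Normc.normcM normcR nl pE.
  rewrite ger0_norm; last by rewrite divr_ge0 ?sqr_ge0 ?ltW.
  rewrite (sqrtrM _ (ltW p0)) sqrtrV ?sqr_ge0// sqrtr_sqr (ger0_norm (ltW g0)).
  rewrite -{1}(sqr_sqrtr (ltW p0)); set q := Num.sqrt _ in q0 *.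
  by field; rewrite !gt_eqF.
(* the scalar product of k and u is 1 / (1 + t) > 0 *)
have nx : t * N <= rnorm x.
  have tN0 : 0 <= t * N := mulr_ge0 (ltW t0) N_ge0.
  rewrite -[_ <= _]ler_sqr ?nnegrE ?rnorm_ge0 ?tN0//.
  have -> : rnorm x ^+ 2 = rnorm k ^+ 2 + rnorm (t%:C *: u) ^+ 2
      + complex.Re (dotL2 (H2val k) (H2val (t%:C *: u))) *+ 2.
    exact: (rnormD_sqr (H2val k) (H2val (t%:C *: u))).
  have -> : dotL2 (H2val k) (H2val (t%:C *: u)) = (t / (1 + t))%:C.
    rewrite [dotL2 _ _]dotL2Zr dotL2_conj.
    have := dotL2_szego nb_neq1 hw nb1 w1.
    rewrite conjcK mulNr opprK mulrC -[b * w]mulrC wb => dE.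
    have -> : dotL2 (H2val u) (H2val k) = ((1 + t)^-1)%:C.
      have t10 : 1 + t%:C != 0 :> R[i].
        apply/eqP => t1; move: dE; rewrite t1 mul0r => /eqP.
        by rewrite eq_sym oner_eq0.
      apply: (mulfI t10); rewrite dE -[1 in RHS]/(1%:C) -rcD -rcM mulfV//.
      by rewrite gt_eqF// ltr_wpDl.
    by rewrite !conjc_real -rcM.
  rewrite rnormZ normcR ger0_norm ?(ltW t0)// rnorm_u addrAC lerDr.
  apply: addr_ge0; first exact: sqr_ge0.
  apply: mulrn_wge0; apply: divr_ge0; first exact: ltW.
  by rewrite addr_ge0// ltW.
have N0 : 0 < N by rewrite -rnorm_u.
have x0 : 0 < rnorm x by apply: lt_le_trans nx; rewrite mulr_gt0.
have Ax0 : 0 < rnorm (scalar_sub l A x) by rewrite nAx.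
have hM : t * N / Num.sqrt (g ^+ 2 - 1) * rnorm (scalar_sub l A x) <= rnorm x.
  by rewrite nAx divfK// gt_eqF.
apply: le_trans (resolvent_bound_ge l1 x0 Ax0 hM).
rewrite lee_fin nl -rate_golden -/g /t le_eqVlt; apply/orP; left; apply/eqP.
by field; rewrite !gt_eqF// -invr_gt0.
Qed.

End PerturbedShift.

Close Scope complex_scope.
Close Scope classical_set_scope.

Theorem theorem3p1 (R : realType) (b : R[i])
    (hb0 : 0 < normc b) (hb1 : normc b < 1) :
  let A : H2 R -> H2 R :=
    op_inv (toeplitz (one_plus_z b)) \o toeplitz (zbar R)
      \o toeplitz (one_plus_z b) in
  let c0 : R :=
    Num.sqrt 2 * (Num.sqrt 5 - 1) / (1 + Num.sqrt 5) `^ (3 / 2) in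
  ((Num.max 1 (normc b / Num.sqrt (1 - normc b ^+ 2)))%:E
     <= power_bound A
     <= (1 + normc b / Num.sqrt (1 - normc b ^+ 2))%:E)%E /\
  ((Num.max 1 (c0 * normc b / Num.sqrt (1 - normc b ^+ 2)))%:E
     <= resolvent_bound A
     <= Order.min (power_bound A)
          (1 + c0 * normc b / Num.sqrt (1 - normc b ^+ 2))%:E)%E.
Proof.
move=> A c; have AE : A = pshift hb1 := toeplitz_conjugate hb1.
rewrite AE -[c * _ / _]mulrA; split; apply/andP; split.
- by rewrite EFin_max ge_max power_bound_ge1 power_bound_ge.
- exact: power_bound_le.
- rewrite EFin_max ge_max; apply/andP; split.
    exact: resolvent_bound_ge1.
  exact: resolvent_bound_ge_const.
- rewrite le_min; apply/andP; split.
    exact: resolvent_bound_le_power_bound.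
  exact: resolvent_bound_le_const.
Qed.
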